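(* The following forgetful functors are all monadic: (a) the functors from the category $\mathcal{C}^*_1$ of unital $C^*$-algebras to the category $\mathrm{BanAlg}^*_1$ of unital Banach $*$-algebras, to the category $\mathrm{BanAlg}_1$ of unital Banach algebras, and to the category $\mathrm{Ban}$ of Banach spaces; (b) the functors from the category $\mathcal{C}^*_{c,1}$ of unital commutative $C^*$-algebras to the category $\mathrm{BanAlg}^*_{c,1}$ of unital commutative Banach $*$-algebras, to the category $\mathrm{BanAlg}_{c,1}$ of unital commutative Banach algebras, and to the category $\mathrm{Ban}$ of Banach spaces.
   Context: All algebras and spaces are over $\mathbb{C}$, and the zero algebra is allowed. Morphisms in $\mathcal{C}^*_1$ and $\mathcal{C}^*_{c,1}$ are unital $*$-homomorphisms. Morphisms of unital Banach algebras are unital contractive (norm $\le 1$) algebra homomorphisms; Banach $*$-algebras are Banach algebras with isometric involution, and their morphisms are unital contractive $*$-homomorphisms. $\mathrm{Ban}$ is the category of complex Banach spaces with linear maps of norm $\le 1$ as morphisms. A functor $G:\mathcal{C}\to\mathcal{D}$ is monadic if it has a left adjoint $F$ and the canonical comparison functor from $\mathcal{C}$ to the Eilenberg-Moore category of algebras over the monad $GF$ on $\mathcal{D}$ is an equivalence. *)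

(* Defs.v *)
From HB Require Import structures.
From mathcomp Require Import all_boot all_order all_algebra.
From mathcomp Require Import complex ring lra.
From mathcomp Require Import boolp classical_sets reals topology normedtype sequences.

Set Implicit Arguments.
Unset Strict Implicit.
Unset Printing Implicit Defensive.

Import Order.TTheory GRing.Theory Num.Theory.
Import numFieldNormedType.Exports.

Local Open Scope ring_scope.
Local Open Scope classical_set_scope.

Reserved Notation "x ** y" (at level 40, left associativity).

(* Banach algebras carry their own product [bmul] and unit [bone]:
   Hierarchy Builder rejects a join of CompleteNormedModule with GRing.PzRing
   (a join of norm and product already occurs in Num.NumDomain), and algType
   would exclude the zero algebra, which is allowed here.  The normalization
   [`|bone| <= 1] means [`|bone| = 1] in a nonzero algebra (because the norm is
   submultiplicative) and holds in the zero algebra. *)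
HB.mixin Record isBanachAlgebra (K : numFieldType) A
    & CompleteNormedModule K A := {
  bone : A;
  bmul : A -> A -> A;
  bmulA : associative bmul;
  bmul1x : left_id bone bmul;
  bmulx1 : right_id bone bmul;
  bmulDl : left_distributive bmul +%R;
  bmulDr : right_distributive bmul +%R;
  bscalerAl : forall (k : K) (x y : A), k *: bmul x y = bmul (k *: x) y;
  bscalerAr : forall (k : K) (x y : A), k *: bmul x y = bmul x (k *: y);
  ler_norm_bmul : forall x y : A, `|bmul x y| <= `|x| * `|y|;
  ler_norm_bone : `|bone| <= 1
}.

#[short(type="banachAlgType")]
HB.structure Definition BanachAlgebra (K : numFieldType) :=
  {A of isBanachAlgebra K A & CompleteNormedModule K A}.

Arguments bone {K s}.
Notation "x ** y" := (bmul x y) : ring_scope.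

HB.mixin Record isCommutativeBanachAlgebra (K : numFieldType) A
    & BanachAlgebra K A := {
  bmulC : commutative (@bmul K A)
}.

#[short(type="comBanachAlgType")]
HB.structure Definition ComBanachAlgebra (K : numFieldType) :=
  {A of BanachAlgebra K A & isCommutativeBanachAlgebra K A}.

HB.mixin Record hasIsometricInvolution (K : numClosedFieldType) A
    & BanachAlgebra K A := {
  star : A -> A;
  starK : involutive star;
  starD : {morph star : x y / x + y};
  starZ : forall (k : K) (x : A), star (k *: x) = k^* *: star x;
  starM : forall x y : A, star (x ** y) = star y ** star x;
  norm_star : forall x : A, `|star x| = `|x|
}.

#[short(type="banachStarAlgType")]
HB.structure Definition BanachStarAlgebra (K : numClosedFieldType) :=
  {A of BanachAlgebra K A & hasIsometricInvolution K A}.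

#[short(type="comBanachStarAlgType")]
HB.structure Definition ComBanachStarAlgebra (K : numClosedFieldType) :=
  {A of BanachStarAlgebra K A & isCommutativeBanachAlgebra K A}.

HB.mixin Record isCStarAlgebra (K : numClosedFieldType) A
    & BanachStarAlgebra K A := {
  cstar_identity : forall x : A, `|star x ** x| = `|x| ^+ 2
}.

#[short(type="cstarAlgType")]
HB.structure Definition CStarAlgebra (K : numClosedFieldType) :=
  {A of BanachStarAlgebra K A & isCStarAlgebra K A}.

#[short(type="comCstarAlgType")]
HB.structure Definition ComCStarAlgebra (K : numClosedFieldType) :=
  {A of CStarAlgebra K A & isCommutativeBanachAlgebra K A}.

(* Unital *-homomorphisms of C*-algebras are contractive, so that the forgetful
   functors below are well defined.  For a self-adjoint k of norm at most 1, the
   fixed point l of z |-> (k k + z z) / 2 gives a self-adjoint c = 1 - l with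
   c c = 1 - k k that commutes with k; then the image of k + i c is a unitary,
   so the image of k has norm at most 1. *)
Local Notation "x %:C" := (x%:C)%C.

Section Majorant.
Variable R : realType.

Definition sqrt_majorant (n : nat) : R := iter n (fun t => 2^-1 * (1 + t * t)) 0.
Local Notation t := sqrt_majorant.

Lemma majorant_bounds n : 0 <= t n /\ t n <= 1.
Proof.
elim: n => [|n [t0 t1]]; first by rewrite /= lexx ler01.
rewrite /sqrt_majorant iterS -/(t n).
split; nra.
Qed.

Lemma majorantS n : t n.+1 = 2^-1 * (1 + t n * t n).
Proof. by []. Qed.

Lemma majorant_nondecreasing : {homo t : n m / (n <= m)%N >-> n <= m}.
Proof.
apply/nondecreasing_seqP => n; rewrite majorantS.
have := sqr_ge0 (t n - 1); lra.
Qed.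

Lemma majorant_cauchy (V : completeNormedModType R[i]) (u : nat -> V) :
  (forall n, `|u n.+1 - u n| <= (t n.+1 - t n)%:C) ->
  exists l : V, forall e : R[i], 0 < e ->
    \forall n \near \oo, `|l - u n| <= e.
Proof.
move=> step.
have dist n k : `|u (n + k)%N - u n| <= (t (n + k)%N - t n)%:C.
  elim: k => [|k IH]; first by rewrite addn0 !subrr normr0.
  rewrite addnS -(subrKA (u (n + k)%N)) -(subrKA (t (n + k)%N)) rmorphD /=.
  by apply: le_trans (ler_normD _ _) (lerD (step _) IH).
have tc : cvgn t.
  apply: (nondecreasing_is_cvgn majorant_nondecreasing).
  by exists 1 => _ [n _ <-]; case: (majorant_bounds n).
suff /cauchy_cvg/cvg_ex[l /cvgrPdist_le ul] : cauchy (u @ \oo) by exists l.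
apply/cauchy_exP => e e0.
have eE : e = (complex.Re e)%:C by rewrite RRe_real // gtr0_real.
have e0' : 0 < complex.Re e by move: e0; rewrite {1}eE ltcR.
have /cvgrPdist_lt /(_ _ e0')[N _ tN] := tc.
exists (u N); exists N => // n /= Nn.
rewrite -ball_normE /= distrC -(subnKC Nn).
apply: le_lt_trans (dist _ _) _.
rewrite eE ltcR subnKC//.
have := tN N (leqnn N).
have tl := nondecreasing_cvgn_le majorant_nondecreasing tc n.
have tl' := nondecreasing_cvgn_le majorant_nondecreasing tc N.
rewrite ger0_norm ?subr_ge0//; lra.
Qed.

Lemma eq0_norm_small (V : normedModType R[i]) (z : V) (C : R[i]) :
  0 <= C -> (forall e, 0 < e -> e <= 1 -> `|z| <= C * e) -> z = 0.
Proof.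
move=> C0 zC; apply/eqP; rewrite -normr_le0.
have zR : `|z| \is Num.real by exact: normr_real.
have CR : C \is Num.real by exact: ger0_real.
apply/ler_addgt0Pr => e e0; rewrite add0r.
have C1 : 0 < C + 1 + e by rewrite addr_gt0// ltr_wpDl.
have eC : 0 < e / (C + 1 + e) by rewrite divr_gt0.
apply: le_trans (zC _ eC _) _.
  by rewrite ler_pdivrMr// mul1r lerDr addr_ge0.
rewrite mulrCA ler_piMr ?(ltW e0)// ler_pdivrMr// mul1r.
by rewrite -addrA lerDl addr_ge0// ltW.
Qed.

End Majorant.

Section Bmul.
Variables (K : numFieldType) (A : banachAlgType K).
Implicit Types x y : A.
Lemma bmulNl x y : (- x) ** y = - (x ** y).
Proof. by rewrite -scaleN1r -bscalerAl scaleN1r. Qed.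
Lemma bmulNr x y : x ** (- y) = - (x ** y).
Proof. by rewrite -scaleN1r -bscalerAr scaleN1r. Qed.
Lemma bmulBl x y z : (x - y) ** z = x ** z - y ** z.
Proof. by rewrite bmulDl bmulNl. Qed.
Lemma bmulBr x y z : x ** (y - z) = x ** y - x ** z.
Proof. by rewrite bmulDr bmulNr. Qed.
Lemma bmul0x y : 0 ** y = 0.
Proof. by rewrite -[X in X ** _](subrr (0 : A)) bmulBl subrr. Qed.
Lemma bmulx0 x : x ** 0 = 0.
Proof. by rewrite -[X in _ ** X](subrr (0 : A)) bmulBr subrr. Qed.
End Bmul.

Section Star.
Variables (K : numClosedFieldType) (A : banachStarAlgType K).
Implicit Types x y : A.
Lemma starN x : star (- x) = - star x.
Proof. by rewrite -scaleN1r starZ rmorphN1 scaleN1r. Qed.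
Lemma starB x y : star (x - y) = star x - star y.
Proof. by rewrite starD starN. Qed.
Lemma star1 : star bone = bone :> A.
Proof. by rewrite -[LHS]bmulx1 -[X in _ ** X]starK -starM bmulx1 starK. Qed.
Lemma star0 : star 0 = 0 :> A.
Proof. by rewrite -[X in star X](subrr (0 : A)) starB subrr. Qed.
End Star.

Section SquareRoot.
Variables (R : realType) (A : banachStarAlgType R[i]).
Local Notation t := (@sqrt_majorant R).

Lemma star_sqrt (k : A) : star k = k -> `|k| <= 1 ->
  exists2 c : A, star c = c & c ** c = bone - k ** k /\ c ** k = k ** c.
Proof.
move=> ks k1; set h := k ** k.
have hs : star h = h by rewrite starM ks.
have h1 : `|h| <= 1.
  by apply: le_trans (ler_norm_bmul _ _) _; rewrite mulr_ile1.
pose y n : A := iter n (fun z => 2^-1 *: (h + z ** z)) 0.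
have yS n : y n.+1 = 2^-1 *: (h + y n ** y n) by [].
have half0 : `|2^-1 : R[i]| = (2^-1)%:C.
  by rewrite ger0_norm ?invr_ge0// fmorphV rmorph_nat.
have C1 : 1 = 1%:C :> R[i] by [].
have yt n : `|y n| <= (t n)%:C.
  elim: n => [|n IH]; first by rewrite normr0.
  rewrite yS majorantS normrZ half0 rmorphM rmorphD rmorphM rmorph1 /=.
  rewrite ler_wpM2l ?ler0c ?invr_ge0//.
  apply: le_trans (ler_normD _ _) (lerD h1 _).
  by apply: le_trans (ler_norm_bmul _ _) _; rewrite ler_pM.
have ystep n : `|y n.+1 - y n| <= (t n.+1 - t n)%:C.
  elim: n => [|n IH].
    by rewrite (_ : y 0%N = 0)// (_ : t 0%N = 0)// !subr0; exact: yt 1%N.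
  have -> : y n.+2 - y n.+1 =
      2^-1 *: (y n.+1 ** (y n.+1 - y n) + (y n.+1 - y n) ** y n).
    rewrite bmulBr bmulBl subrKA [y n.+2]yS [X in _ - X]yS -scalerBr.
    by rewrite opprD addrACA subrr add0r.
  have -> : t n.+2 - t n.+1 =
      2^-1 * (t n.+1 * (t n.+1 - t n) + (t n.+1 - t n) * t n).
    by rewrite [t n.+2]majorantS [X in _ - X]majorantS; ring.
  have -> : (2^-1 * (t n.+1 * (t n.+1 - t n) + (t n.+1 - t n) * t n))%:C =
      (2^-1)%:C * ((t n.+1)%:C * (t n.+1 - t n)%:C + (t n.+1 - t n)%:C * (t n)%:C).
    by rewrite -!rmorphM -rmorphD -rmorphM.
  rewrite normrZ half0 ler_wpM2l ?ler0c ?invr_ge0//.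
  apply: le_trans (ler_normD _ _) (lerD _ _);
    by apply: le_trans (ler_norm_bmul _ _) _; rewrite ler_pM ?yt ?IH.
have [l yl] := majorant_cauchy ystep.
have ysa n : star (y n) = y n.
  elim: n => [|n IH]; first exact: star0.
  by rewrite yS starZ starD hs starM IH fmorphV rmorph_nat.
have ycomm n : y n ** k = k ** y n.
  elim: n => [|n IH].
    by rewrite (_ : y 0%N = 0)// bmul0x bmulx0.
  by rewrite yS -bscalerAl -bscalerAr bmulDl bmulDr bmulA -!bmulA IH !bmulA IH.
have lsa : star l = l.
  apply/eqP; rewrite -subr_eq0; apply/eqP.
  apply: (@eq0_norm_small _ _ _ 2) => // e e0 _.
  have [N _ /(_ N (leqnn N)) /= lN] := yl e e0.
  rewrite -(subrKA (y N)) mulr_natl mulr2n.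
  apply: le_trans (ler_normD _ _) (lerD _ _).
    by rewrite -{1}(ysa N) -starB norm_star.
  by rewrite distrC.
have lcomm : l ** k = k ** l.
  apply/eqP; rewrite -subr_eq0; apply/eqP.
  apply: (@eq0_norm_small _ _ _ 2) => // e e0 _.
  have [N _ /(_ N (leqnn N)) /= lN] := yl e e0.
  rewrite -(subrKA (y N ** k)) [X in _ + (X - _)]ycomm -bmulBl -bmulBr mulr_natl mulr2n.
  apply: le_trans (ler_normD _ _) (lerD _ _);
    apply: le_trans (ler_norm_bmul _ _) _.
    by rewrite -[e]mulr1 ler_pM.
  by rewrite -[e]mul1r ler_pM// distrC.
have lfix : l = 2^-1 *: (h + l ** l).
  apply/eqP; rewrite -subr_eq0; apply/eqP.
  apply: (@eq0_norm_small _ _ _ (1 + (1 + `|l|))) => // [|e e0 e1].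
    by rewrite !addr_ge0.
  have [N _ yN] := yl e e0.
  have lN : `|l - y N| <= e by apply: yN => /=.
  have lN1 : `|l - y N.+1| <= e by apply: yN => /=.
  have -> : l - 2^-1 *: (h + l ** l) = (l - y N.+1)
     + 2^-1 *: ((y N - l) ** y N + l ** (y N - l)).
    rewrite bmulBl bmulBr subrKA -(subrKA (y N.+1) l); congr (_ + _).
    by rewrite yS -scalerBr opprD addrACA subrr add0r.
  have yN1 : `|y N| <= 1.
    by apply: le_trans (yt N) _; rewrite [leRHS]C1 lecR; case: (majorant_bounds R N).
  rewrite mulrDl mul1r; apply: le_trans (ler_normD _ _) (lerD lN1 _).
  rewrite normrZ half0 mulrDl mul1r.
  have lN' : `|y N - l| <= e by rewrite distrC.
  apply: (@le_trans _ _ (`|(y N - l) ** y N + l ** (y N - l)|)).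
    by rewrite ler_piMl// [leRHS]C1 lecR invf_le1// ler1n.
  apply: le_trans (ler_normD _ _) (lerD _ _);
    apply: le_trans (ler_norm_bmul _ _) _; last by rewrite ler_wpM2l.
  by rewrite -[e]mulr1 ler_pM.
exists (bone - l); first by rewrite starB star1 lsa.
split; last by rewrite bmulBl bmulBr bmul1x bmulx1 lcomm.
have -> : h = 2 *: l - l ** l.
  by rewrite lfix scalerA divff ?pnatr_eq0// scale1r -lfix addrK.
rewrite bmulBl !bmulBr !bmul1x bmulx1 scaler_nat mulr2n.
rewrite !opprB opprD !addrA; congr (_ - l).
by rewrite addrAC.
Qed.
End SquareRoot.

Lemma cstar_hom_contractive (R : realType) (A B : cstarAlgType R[i]) (f : A -> B) :
  linear f -> f bone = bone -> {morph f : x y / x ** y} ->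
  {morph f : x / star x} -> forall x, `|f x| <= `|x|.
Proof.
move=> flin f1 fM fS x.
pose F : {linear A -> B} := HB.pack f (GRing.isLinear.Build _ _ _ _ f flin).
have f0 : f 0 = 0 := raddf0 F.
have fB a b : f (a - b) = f a - f b := raddfB F a b.
have fZ k a : f (k *: a) = k *: f a := linearZ_LR F k a.
have [->|x0] := eqVneq x 0; first by rewrite f0 !normr0.
have nx : 0 < `|x| by rewrite normr_gt0.
pose h : A := `|x| ^- 2 *: (star x ** x).
have hs : star h = h.
  rewrite /h starZ starM starK; congr (_ *: _).
  by rewrite fmorphV rmorphXn /= conj_Creal ?normr_real.
have h1 : `|h| <= 1.
  by rewrite normrZ cstar_identity normfV ger0_norm ?exprn_ge0// mulVf// expf_neq0 ?gt_eqF.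
have [c cs [cc ch]] := star_sqrt hs h1.
have fh1 : `|f h| <= 1.
  pose u v : B := f h + v *: f c.
  have fcs : star (f c) = f c by rewrite -fS cs.
  have fhs : star (f h) = f h by rewrite -fS hs.
  have u1 v : v^* = - v -> v * v = -1 -> `|u v| <= 1.
    move=> vs vv; rewrite -(@expr_le1 _ 2)// -cstar_identity.
    suff -> : star (u v) ** u v = bone by exact: ler_norm_bone.
    rewrite /u starD starZ fhs fcs vs bmulDl !bmulDr.
    rewrite -!bscalerAl -!bscalerAr -!fM ch scalerA mulNr vv opprK scale1r cc.
    by rewrite scaleNr addrA addrK fB f1 addrC subrK.
  have ii : 'i * 'i = -1 :> R[i] by rewrite -expr2 sqrCi.
  have -> : f h = 2^-1 *: (u 'i + u (- 'i)).
    rewrite /u scaleNr addrACA subrr addr0.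
    have -> : f h + f h = 2 *: f h by rewrite scaler_nat mulr2n.
    by rewrite scalerA mulVf ?scale1r// pnatr_eq0.
  rewrite normrZ ger0_norm ?invr_ge0// ler_pdivrMl// mulr1.
  apply: le_trans (ler_normD _ _) _; rewrite -[2]/(1 + 1) lerD// u1//.
  - exact: conjCi.
  - by rewrite rmorphN /= conjCi.
  - by rewrite mulrNN.
move: fh1; rewrite /h fZ fM fS normrZ cstar_identity normfV.
rewrite ger0_norm ?exprn_ge0// ler_pdivrMl ?exprn_gt0// mulr1.
by rewrite ler_pXn2r// nnegrE.
Qed.

Declare Scope cat_scope.
Delimit Scope cat_scope with cat.
Local Open Scope cat_scope.

Record category := Category {
  obj :> Type;
  hom : obj -> obj -> Type;
  cid : forall a, hom a a;
  ccomp : forall a b c, hom b c -> hom a b -> hom a c;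
  ccompA : forall a b c d (h : hom c d) (g : hom b c) (f : hom a b),
    ccomp h (ccomp g f) = ccomp (ccomp h g) f;
  ccomp1f : forall a b (f : hom a b), ccomp (cid b) f = f;
  ccompf1 : forall a b (f : hom a b), ccomp f (cid a) = f
}.
Arguments cid {c} a : rename.

Notation "g ∘ f" := (ccomp g f) (at level 40, left associativity) : cat_scope.

Definition is_iso (C : category) (a b : C) (f : hom a b) : Prop :=
  exists g : hom b a, g ∘ f = cid a /\ f ∘ g = cid b.

Record functor (C D : category) := Functor {
  fobj :> C -> D;
  fmap : forall a b, hom a b -> hom (fobj a) (fobj b);
  fmap1 : forall a, fmap (cid a) = cid (fobj a);
  fmapM : forall a b c (g : hom b c) (f : hom a b),
    fmap (g ∘ f) = fmap g ∘ fmap f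
}.
Arguments fmap {C D} F {a b} f : rename.

Definition functor_id (C : category) : functor C C :=
  @Functor C C (fun a => a) (fun _ _ f => f)
    (fun _ => erefl) (fun _ _ _ _ _ => erefl).

Section FunctorComp.
Variables (C D E : category) (G : functor D E) (F : functor C D).

Lemma functor_comp1 a : fmap G (fmap F (cid a)) = cid (G (F a)).
Proof. by rewrite !fmap1. Qed.

Lemma functor_compM a b c (g : hom b c) (f : hom a b) :
  fmap G (fmap F (g ∘ f)) = fmap G (fmap F g) ∘ fmap G (fmap F f).
Proof. by rewrite !fmapM. Qed.

Definition functor_comp : functor C E :=
  @Functor C E (fun a => G (F a)) (fun _ _ f => fmap G (fmap F f))
    functor_comp1 functor_compM.

End FunctorComp.

Record nat_trans (C D : category) (F G : functor C D) := NatTrans {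
  component :> forall a, hom (F a) (G a);
  naturality : forall a b (f : hom a b),
    fmap G f ∘ component a = component b ∘ fmap F f
}.

Definition nat_isomorphic (C D : category) (F G : functor C D) : Prop :=
  exists alpha : nat_trans F G, forall a, is_iso (alpha a).

Definition is_equivalence (C D : category) (F : functor C D) : Prop :=
  exists G : functor D C,
    nat_isomorphic (functor_comp G F) (functor_id C) /\
    nat_isomorphic (functor_comp F G) (functor_id D).

(* [adjunction F G] : F is left adjoint to G *)
Record adjunction (C D : category) (F : functor D C) (G : functor C D) :=
  Adjunction {
  adj_unit : nat_trans (functor_id D) (functor_comp G F);
  adj_counit : nat_trans (functor_comp F G) (functor_id C);
  adj_triangleL : forall d : D,
    adj_counit (F d) ∘ fmap F (adj_unit d) = cid (F d);
  adj_triangleR : forall c : C,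
    fmap G (adj_counit c) ∘ adj_unit (G c) = cid (G c)
}.

Record monad (D : category) := Monad {
  monad_functor :> functor D D;
  monad_unit : nat_trans (functor_id D) monad_functor;
  monad_mul : nat_trans (functor_comp monad_functor monad_functor)
                        monad_functor;
  monad_mulA : forall d : D,
    monad_mul d ∘ fmap monad_functor (monad_mul d) =
    monad_mul d ∘ monad_mul (monad_functor d);
  monad_mul1l : forall d : D,
    monad_mul d ∘ monad_unit (monad_functor d) = cid (monad_functor d);
  monad_mul1r : forall d : D,
    monad_mul d ∘ fmap monad_functor (monad_unit d) = cid (monad_functor d)
}.

Section EilenbergMoore.
Variables (D : category) (T : monad D).

Record em_algebra := EMAlgebra {
  em_carrier :> D;
  em_struct : hom (T em_carrier) em_carrier;
  em_unit : em_struct ∘ monad_unit T em_carrier = cid em_carrier;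
  em_assoc : em_struct ∘ fmap T em_struct = em_struct ∘ monad_mul T em_carrier
}.

Record em_hom (X Y : em_algebra) := EMHom {
  em_fun :> hom (em_carrier X) (em_carrier Y);
  em_fun_struct : em_fun ∘ em_struct X = em_struct Y ∘ fmap T em_fun
}.

Lemma em_hom_eq X Y (f g : em_hom X Y) : em_fun f = em_fun g -> f = g.
Proof.
case: f g => [f Hf] [g Hg] /= fg; rewrite -{}fg in Hg *.
by rewrite (Prop_irrelevance Hf Hg).
Qed.

Lemma em_id_subproof (X : em_algebra) :
  cid (em_carrier X) ∘ em_struct X = em_struct X ∘ fmap T (cid (em_carrier X)).
Proof. by rewrite fmap1 ccomp1f ccompf1. Qed.

Lemma em_comp_subproof X Y Z (g : em_hom Y Z) (f : em_hom X Y) :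
  (em_fun g ∘ em_fun f) ∘ em_struct X =
  em_struct Z ∘ fmap T (em_fun g ∘ em_fun f).
Proof.
by rewrite fmapM ccompA -em_fun_struct -!ccompA em_fun_struct.
Qed.

Definition em_id X : em_hom X X := EMHom (em_id_subproof X).
Definition em_comp X Y Z (g : em_hom Y Z) (f : em_hom X Y) : em_hom X Z :=
  EMHom (em_comp_subproof g f).

Lemma em_compA X Y Z W (h : em_hom Z W) (g : em_hom Y Z) (f : em_hom X Y) :
  em_comp h (em_comp g f) = em_comp (em_comp h g) f.
Proof. by apply: em_hom_eq; rewrite /= ccompA. Qed.

Lemma em_comp1f X Y (f : em_hom X Y) : em_comp (em_id Y) f = f.
Proof. by apply: em_hom_eq; rewrite /= ccomp1f. Qed.

Lemma em_compf1 X Y (f : em_hom X Y) : em_comp f (em_id X) = f.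
Proof. by apply: em_hom_eq; rewrite /= ccompf1. Qed.

Definition em_category : category := Category em_compA em_comp1f em_compf1.

End EilenbergMoore.

Section Comparison.
Variables (C D : category) (F : functor D C) (G : functor C D).
Variable adj : adjunction F G.

Lemma adj_mul_natural a b (f : hom a b) :
  fmap (functor_comp G F) f ∘ fmap G (adj_counit adj (F a)) =
  fmap G (adj_counit adj (F b)) ∘
    fmap (functor_comp (functor_comp G F) (functor_comp G F)) f.
Proof.
by rewrite /= -!fmapM (naturality (adj_counit adj) (fmap F f)).
Qed.

Definition adj_mul :
    nat_trans (functor_comp (functor_comp G F) (functor_comp G F))
              (functor_comp G F) :=
  @NatTrans _ _ (functor_comp (functor_comp G F) (functor_comp G F))
    (functor_comp G F) (fun d => fmap G (adj_counit adj (F d))) adj_mul_natural.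

Lemma adj_mulA d :
  adj_mul d ∘ fmap (functor_comp G F) (adj_mul d) =
  adj_mul d ∘ adj_mul (functor_comp G F d).
Proof.
by rewrite /= -!fmapM -(naturality (adj_counit adj) (adj_counit adj (F d))).
Qed.

Lemma adj_mul1l d :
  adj_mul d ∘ adj_unit adj (functor_comp G F d) = cid (functor_comp G F d).
Proof. exact: (adj_triangleR adj (F d)). Qed.

Lemma adj_mul1r d :
  adj_mul d ∘ fmap (functor_comp G F) (adj_unit adj d) =
  cid (functor_comp G F d).
Proof. by rewrite /= -fmapM adj_triangleL fmap1. Qed.

Definition adj_monad : monad D := Monad adj_mulA adj_mul1l adj_mul1r.

Lemma comparison_assoc c :
  fmap G (adj_counit adj c) ∘ fmap adj_monad (fmap G (adj_counit adj c)) =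
  fmap G (adj_counit adj c) ∘ monad_mul adj_monad (G c).
Proof.
by rewrite /= -!fmapM -(naturality (adj_counit adj) (adj_counit adj c)).
Qed.

Definition comparison_obj (c : C) : em_category adj_monad :=
  @EMAlgebra D adj_monad (G c) (fmap G (adj_counit adj c))
    (adj_triangleR adj c) (comparison_assoc c).

Lemma comparison_map_subproof a b (f : hom a b) :
  fmap G f ∘ em_struct (comparison_obj a) =
  em_struct (comparison_obj b) ∘ fmap adj_monad (fmap G f).
Proof. by rewrite /= -!fmapM -(naturality (adj_counit adj) f). Qed.

Definition comparison_map a b (f : hom a b) :
    hom (comparison_obj a) (comparison_obj b) :=
  @EMHom D adj_monad (comparison_obj a) (comparison_obj b) (fmap G f)
    (comparison_map_subproof f).

Lemma comparison1 a : comparison_map (cid a) = cid (comparison_obj a).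
Proof. by apply: em_hom_eq; rewrite /= fmap1. Qed.

Lemma comparisonM a b c (g : hom b c) (f : hom a b) :
  comparison_map (g ∘ f) = comparison_map g ∘ comparison_map f.
Proof. by apply: em_hom_eq; rewrite /= fmapM. Qed.

Definition comparison : functor C (em_category adj_monad) :=
  Functor comparison1 comparisonM.

End Comparison.

Definition monadic (C D : category) (G : functor C D) : Prop :=
  exists (F : functor D C) (adj : adjunction F G),
    is_equivalence (comparison adj).

Section ConcreteCategory.
Variables (O : Type) (car : O -> Type).
Variable mor : forall A B : O, (car A -> car B) -> Prop.
Hypothesis mor_id : forall A, @mor A A id.
Hypothesis mor_comp : forall A B C (g : car B -> car C) (f : car A -> car B),
  mor g -> mor f -> mor (g \o f).

Definition mor_hom (A B : O) := {f : car A -> car B | mor f}.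

Lemma mor_hom_eq A B (f g : mor_hom A B) : sval f = sval g -> f = g.
Proof. by apply: eq_sig_hprop => h; exact: Prop_irrelevance. Qed.

Definition mor_hom_id A : mor_hom A A := exist _ id (mor_id A).
Definition mor_hom_comp A B C (g : mor_hom B C) (f : mor_hom A B) :
    mor_hom A C :=
  exist _ (sval g \o sval f) (mor_comp (svalP g) (svalP f)).

Lemma mor_hom_compA A B C D (h : mor_hom C D) (g : mor_hom B C)
    (f : mor_hom A B) :
  mor_hom_comp h (mor_hom_comp g f) = mor_hom_comp (mor_hom_comp h g) f.
Proof. exact: mor_hom_eq. Qed.

Lemma mor_hom_comp1f A B (f : mor_hom A B) :
  mor_hom_comp (mor_hom_id B) f = f.
Proof. exact: mor_hom_eq. Qed.

Lemma mor_hom_compf1 A B (f : mor_hom A B) :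
  mor_hom_comp f (mor_hom_id A) = f.
Proof. exact: mor_hom_eq. Qed.

Definition concrete_category : category :=
  Category mor_hom_compA mor_hom_comp1f mor_hom_compf1.

End ConcreteCategory.

(* The functor that keeps the underlying sets and maps, for a map [U] on
   objects that preserves the carriers definitionally. *)
Section ForgetfulFunctor.
Variables (O1 O2 : Type) (U : O1 -> O2) (car : O2 -> Type).
Variable mor1 : forall A B : O1, (car (U A) -> car (U B)) -> Prop.
Variable mor2 : forall A B : O2, (car A -> car B) -> Prop.
Hypothesis mor1_id : forall A, @mor1 A A id.
Hypothesis mor1_comp : forall A B C (g : car (U B) -> car (U C))
  (f : car (U A) -> car (U B)), mor1 g -> mor1 f -> mor1 (g \o f).
Hypothesis mor2_id : forall A, @mor2 A A id.
Hypothesis mor2_comp : forall A B C (g : car B -> car C) (f : car A -> car B),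
  mor2 g -> mor2 f -> mor2 (g \o f).
Hypothesis mor12 : forall A B (f : car (U A) -> car (U B)), mor1 f -> mor2 f.

Let C1 := concrete_category mor1_id mor1_comp.
Let C2 := concrete_category mor2_id mor2_comp.

Definition forget_map (A B : C1) (f : hom A B) :
    hom (U A : C2) (U B : C2) :=
  exist _ (sval f) (mor12 (svalP f)).

Lemma forget_map1 (A : C1) : forget_map (cid A) = cid (U A : C2).
Proof. exact: mor_hom_eq. Qed.

Lemma forget_mapM (A B C : C1) (g : hom B C) (f : hom A B) :
  forget_map (g ∘ f) = forget_map g ∘ forget_map f.
Proof. exact: mor_hom_eq. Qed.

Definition forgetful : functor C1 C2 := Functor forget_map1 forget_mapM.

End ForgetfulFunctor.

Definition ban_mor (K : numFieldType) (V W : completeNormedModType K)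
    (f : V -> W) : Prop :=
  linear f /\ forall x, `|f x| <= `|x|.

Definition banalg_mor (K : numFieldType) (A B : banachAlgType K)
    (f : A -> B) : Prop :=
  [/\ linear f, f bone = bone, {morph f : x y / x ** y} &
      forall x, `|f x| <= `|x|].

Definition banstaralg_mor (K : numClosedFieldType) (A B : banachStarAlgType K)
    (f : A -> B) : Prop :=
  [/\ linear f, f bone = bone, {morph f : x y / x ** y},
      {morph f : x / star x} & forall x, `|f x| <= `|x|].

Definition cstar_mor (K : numClosedFieldType) (A B : cstarAlgType K)
    (f : A -> B) : Prop :=
  [/\ linear f, f bone = bone, {morph f : x y / x ** y} &
      {morph f : x / star x}].

Lemma linear_comp (K : numFieldType) (U V W : lmodType K) (g : V -> W)
  (f : U -> V) : linear g -> linear f -> linear (g \o f).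
Proof. by move=> gl fl k x y; rewrite /= fl gl. Qed.

Lemma ban_mor_id (K : numFieldType) (V : completeNormedModType K) :
  @ban_mor K V V id.
Proof. by split. Qed.

Lemma ban_mor_comp (K : numFieldType) (U V W : completeNormedModType K)
  (g : V -> W) (f : U -> V) : ban_mor g -> ban_mor f -> ban_mor (g \o f).
Proof.
move=> [gl gn] [fl fn]; split=> [|x]; first exact: linear_comp.
exact: le_trans (gn _) (fn _).
Qed.

Lemma banalg_mor_id (K : numFieldType) (A : banachAlgType K) :
  @banalg_mor K A A id.
Proof. by split. Qed.

Lemma banalg_mor_comp (K : numFieldType) (A B C : banachAlgType K)
  (g : B -> C) (f : A -> B) :
  banalg_mor g -> banalg_mor f -> banalg_mor (g \o f).
Proof.
move=> [gl g1 gM gn] [fl f1 fM fn]; split=> [||x y|x] /=.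
- exact: linear_comp.
- by rewrite f1.
- by rewrite fM gM.
- exact: le_trans (gn _) (fn _).
Qed.

Lemma banstaralg_mor_id (K : numClosedFieldType) (A : banachStarAlgType K) :
  @banstaralg_mor K A A id.
Proof. by split. Qed.

Lemma banstaralg_mor_comp (K : numClosedFieldType)
  (A B C : banachStarAlgType K) (g : B -> C) (f : A -> B) :
  banstaralg_mor g -> banstaralg_mor f -> banstaralg_mor (g \o f).
Proof.
move=> [gl g1 gM gS gn] [fl f1 fM fS fn]; split=> [||x y|x|x] /=.
- exact: linear_comp.
- by rewrite f1.
- by rewrite fM gM.
- by rewrite fS gS.
- exact: le_trans (gn _) (fn _).
Qed.

Lemma cstar_mor_id (K : numClosedFieldType) (A : cstarAlgType K) :
  @cstar_mor K A A id.
Proof. by split. Qed.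

Lemma cstar_mor_comp (K : numClosedFieldType) (A B C : cstarAlgType K)
  (g : B -> C) (f : A -> B) :
  cstar_mor g -> cstar_mor f -> cstar_mor (g \o f).
Proof.
move=> [gl g1 gM gS] [fl f1 fM fS]; split=> [||x y|x] /=.
- exact: linear_comp.
- by rewrite f1.
- by rewrite fM gM.
- by rewrite fS gS.
Qed.

Section Categories.
Variable R : realType.
Local Notation C := R[i].

Definition Ban : category :=
  concrete_category (@ban_mor_id C) (@ban_mor_comp C).

Definition BanAlg1 : category :=
  concrete_category (@banalg_mor_id C) (@banalg_mor_comp C).

Definition BanAlgStar1 : category :=
  concrete_category (@banstaralg_mor_id C) (@banstaralg_mor_comp C).

Definition CStar1 : category :=
  concrete_category (@cstar_mor_id C) (@cstar_mor_comp C).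

Definition BanAlgc1 : category :=
  @concrete_category (comBanachAlgType C) (fun A => A)
    (fun A B f => @banalg_mor C A B f)
    (fun A => @banalg_mor_id C A) (fun A B D => @banalg_mor_comp C A B D).

Definition BanAlgStarc1 : category :=
  @concrete_category (comBanachStarAlgType C) (fun A => A)
    (fun A B f => @banstaralg_mor C A B f)
    (fun A => @banstaralg_mor_id C A)
    (fun A B D => @banstaralg_mor_comp C A B D).

Definition CStarc1 : category :=
  @concrete_category (comCstarAlgType C) (fun A => A)
    (fun A B f => @cstar_mor C A B f)
    (fun A => @cstar_mor_id C A) (fun A B D => @cstar_mor_comp C A B D).

Lemma cstar_mor_banstaralg (A B : cstarAlgType C) (f : A -> B) :
  cstar_mor f -> banstaralg_mor f.
Proof.
by move=> [fl f1 fM fS]; split=> //; exact: cstar_hom_contractive.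
Qed.

Lemma cstar_mor_banalg (A B : cstarAlgType C) (f : A -> B) :
  cstar_mor f -> banalg_mor f.
Proof. by move=> /cstar_mor_banstaralg[]. Qed.

Lemma cstar_mor_ban (A B : cstarAlgType C) (f : A -> B) :
  cstar_mor f -> ban_mor f.
Proof. by move=> /cstar_mor_banstaralg[]. Qed.

Definition CStar1_to_BanAlgStar1 : functor CStar1 BanAlgStar1 :=
  @forgetful (cstarAlgType C) (banachStarAlgType C) (fun A => A) (fun A => A)
    _ _ _ _ _ _ cstar_mor_banstaralg.

Definition CStar1_to_BanAlg1 : functor CStar1 BanAlg1 :=
  @forgetful (cstarAlgType C) (banachAlgType C) (fun A => A) (fun A => A)
    _ _ _ _ _ _ cstar_mor_banalg.

Definition CStar1_to_Ban : functor CStar1 Ban :=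
  @forgetful (cstarAlgType C) (completeNormedModType C) (fun A => A)
    (fun A => A) _ _ _ _ _ _ cstar_mor_ban.

Definition CStarc1_to_BanAlgStarc1 : functor CStarc1 BanAlgStarc1 :=
  @forgetful (comCstarAlgType C) (comBanachStarAlgType C) (fun A => A)
    (fun A => A) _ _ _ _ _ _ (fun A B => @cstar_mor_banstaralg A B).

Definition CStarc1_to_BanAlgc1 : functor CStarc1 BanAlgc1 :=
  @forgetful (comCstarAlgType C) (comBanachAlgType C) (fun A => A)
    (fun A => A) _ _ _ _ _ _ (fun A B => @cstar_mor_banalg A B).

Definition CStarc1_to_Ban : functor CStarc1 Ban :=
  @forgetful (comCstarAlgType C) (completeNormedModType C) (fun A => A)
    (fun A => A) _ _ _ _ _ _ (fun A B => @cstar_mor_ban A B).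

End Categories.

(* Main.v *)
From HB Require Import structures.
From mathcomp Require Import all_boot all_order all_algebra.
From mathcomp Require Import complex.
From mathcomp Require Import boolp classical_sets reals.
From mathcomp Require Import topology normedtype sequences.
Require Import Defs.

(* Each forgetful functor is treated by Beck's criterion.

   Left adjoints: the free C*-algebra on a Banach space or algebra X consists
   of formal C*-expressions in X, closed under limits that converge uniformly in
   all representations f : X -> A, modulo equality of all evaluations; its norm
   is the supremum of the evaluated norms, taken over all representations.

   Split pairs: let a : A -> X split, as a contraction s : X -> A in Banach
   spaces, a parallel pair of *-homomorphisms into A.  The splitting forces
   a (x y) and a (star x) to depend only on a x and a y, so X inherits a product
   and an involution.  The norm of X is the quotient norm because of s, and the
   C*-identity is the usual one for quotients by closed *-ideals: if
   p* p = w + k with k = k* in the kernel and |k| <= 1, then the Cesaro means g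
   of the powers of 1 - k^2 satisfy |g| <= 1, a (p g) = a p and |k g| -> 0, so
   that |p g|^2 = |g p* p g| <= |w| + |k g|. *)

Set Implicit Arguments.
Unset Strict Implicit.
Unset Printing Implicit Defensive.

Import Order.TTheory GRing.Theory Num.Theory.
Import numFieldNormedType.Exports.

Local Open Scope ring_scope.
Local Open Scope classical_set_scope.

(** * C*-estimates and quotients *)

Section CStarEstimates.
Variables (R : realType) (A : cstarAlgType R[i]).
Implicit Types k g x : A.

Lemma norm_le1_unitary x : star x ** x = bone -> `|x| <= 1.
Proof.
by move=> u; rewrite -(@expr_le1 _ 2)// -cstar_identity u ler_norm_bone.
Qed.

(* With [c ** c = bone - k ** k] and [c] commuting with [k], the element
   [c + 'i k] is unitary and [c] is its self-adjoint part. *)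
Lemma norm_bone_sub_sq k : star k = k -> `|k| <= 1 -> `|bone - k ** k| <= 1.
Proof.
move=> ks k1; have [c cs [cc ck]] := star_sqrt ks k1.
pose z := c + 'i *: k.
have z1 : `|z| <= 1.
  apply: norm_le1_unitary.
  rewrite /z starD starZ cs ks conjCi bmulDl !bmulDr -!bscalerAl -!bscalerAr.
  rewrite ck cc scalerA mulNr -expr2 sqrCi opprK scale1r scaleNr.
  by rewrite addrA addrK subrK.
have cz : c = 2^-1 *: (z + star z).
  rewrite /z starD starZ cs ks conjCi scaleNr addrACA subrr addr0.
  have -> : c + c = 2 *: c by rewrite scaler_nat mulr2n.
  by rewrite scalerA mulVf ?scale1r// pnatr_eq0.
have c1 : `|c| <= 1.
  rewrite cz normrZ ger0_norm ?invr_ge0// ler_pdivrMl// mulr1.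
  by apply: le_trans (ler_normD _ _) _; rewrite norm_star -[2]/(1 + 1) lerD.
by rewrite -cc (le_trans (ler_norm_bmul _ _))// mulr_ile1.
Qed.

(* [g] is the Cesaro mean of the powers of [bone - k ** k]. *)
Lemma approximate_unit k (e : R[i]) : star k = k -> `|k| <= 1 -> 0 < e ->
  exists g, [/\ star g = g, `|g| <= 1, `|k ** g| <= e &
                exists r, g = bone + k ** r].
Proof.
move=> ks k1 e0; have [y yE] : exists y, y = bone - k ** k by eexists.
have y1 : `|y| <= 1 by rewrite yE norm_bone_sub_sq.
have ys : star y = y by rewrite yE starB star1 starM ks.
have yk : y ** k = k ** y by rewrite yE bmulBl bmulBr bmul1x bmulx1 bmulA.
(* Horner form: [S n] is the sum of the powers of [y] with exponents below [n], and [P n] is the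
   power with exponent [n]. *)
pose S n : A := iter n (fun t => bone + y ** t) 0.
pose P n : A := iter n (bmul y) bone.
have SS n : S n.+1 = bone + y ** S n by [].
have kS n : k ** S n = S n ** k.
  elim: n => [|n IH]; first by rewrite bmulx0 bmul0x.
  by rewrite SS bmulDl bmulDr bmul1x bmulx1 -bmulA -IH !bmulA yk.
have yS n : y ** S n = S n ** y.
  by rewrite yE bmulBl bmulBr bmul1x bmulx1 -bmulA kS bmulA kS bmulA.
have Ss n : star (S n) = S n.
  elim: n => [|n IH]; first exact: star0.
  by rewrite SS starD star1 starM ys IH yS.
have Sn n : `|S n| <= n%:R.
  elim: n => [|n IH]; first by rewrite normr0.
  rewrite SS -natr1 addrC (le_trans (ler_normD _ _))// lerD ?ler_norm_bone//.
  rewrite (le_trans (ler_norm_bmul _ _))// -[leRHS]mul1r ler_pM//.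
have Pn n : `|P n| <= 1.
  elim: n => [|n IH]; first exact: ler_norm_bone.
  by rewrite (le_trans (ler_norm_bmul _ _))// mulr_ile1.
(* Geometric sum: [k ** k] equals [bone - y], so its product with [S n] telescopes. *)
have kkS n : k ** (k ** S n) = bone - P n.
  elim: n => [|n IH]; first by rewrite !bmulx0 subrr.
  rewrite SS !bmulDr bmulx1 !bmulA.
  have -> : k ** k ** y = y ** (k ** k) by rewrite -bmulA -yk !bmulA yk.
  rewrite -[_ ** (k ** k) ** S n]bmulA -[k ** k ** S n]bmulA IH bmulBr.
  rewrite bmulx1 addrA.
  by rewrite {1}yE addrCA subrr addr0.
(* Each power of [y] is congruent to [bone] modulo the right ideal generated by [k]. *)
have Sr n : exists r, S n = n%:R *: bone + k ** r.
  elim: n => [|n [r IH]]; first by exists 0; rewrite bmulx0 scale0r addr0.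
  exists (r - k ** S n); rewrite SS yE bmulBl bmul1x bmulBr -bmulA {1}IH.
  by rewrite -natr1 scalerDl scale1r !addrA [bone + _]addrC.
have eE : e = (complex.Re e)%:C%C by rewrite RRe_real // gtr0_real.
(* By the C*-identity [|k ** g| ^+ 2] is at most [|k ** (k ** g)|], which is the norm of
   [bone - P N] divided by [N], hence at most [2 / N]. *)
have [N N0 Ne] : exists2 N, (0 < N)%N & 2 <= N%:R * e ^+ 2.
  have e0' : 0 < complex.Re e by move: e0; rewrite {1}eE ltcR.
  set r := complex.Re e in eE e0'.
  have r2 : 0 <= 2 / r ^+ 2 by rewrite divr_ge0 ?exprn_ge0 ?(ltW e0').
  have [N HN] : exists N, 2 / r ^+ 2 < N%:R by eexists; exact: archi_boundP r2.
  exists N.+1 => //; rewrite eE -rmorphXn /=.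
  have -> : N.+1%:R = (N.+1%:R : R)%:C%C :> R[i] by rewrite rmorph_nat.
  have -> : 2 = (2 : R)%:C%C :> R[i] by rewrite rmorph_nat.
  rewrite -rmorphM lecR -ler_pdivrMr ?exprn_gt0// ltW// (lt_trans HN)//.
  by rewrite ltr_nat.
have N0' : 0 < N%:R :> R[i] by rewrite ltr0n.
have NV : N%:R^-1 * N%:R = 1 :> R[i] by rewrite mulVf// gt_eqF.
have nN : `|N%:R^-1 : R[i]| = N%:R^-1 by rewrite ger0_norm// invr_ge0 ltW.
pose g := N%:R^-1 *: S N.
have gs : star g = g by rewrite /g starZ Ss fmorphV rmorph_nat.
have g1 : `|g| <= 1 by rewrite normrZ nN ler_pdivrMl// mulr1.
exists g; split => //; last first.
  have [r Hr] := Sr N; exists (N%:R^-1 *: r).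
  by rewrite /g Hr scalerDr scalerA NV scale1r bscalerAr.
rewrite -(@ler_pXn2r _ 2)// ?nnegrE ?(ltW e0)// -cstar_identity.
rewrite starM gs ks -bmulA (le_trans (ler_norm_bmul _ _))//.
apply: (@le_trans _ _ `|k ** (k ** g)|); first by rewrite ler_piMl.
rewrite /g -!bscalerAr kkS normrZ nN ler_pdivrMl//.
apply: le_trans Ne; rewrite -[2]/(1 + 1) (le_trans (ler_normB _ _))// lerD//.
exact: ler_norm_bone.
Qed.

(* The C*-inequality for the norm of the quotient by an ideal that contains
   [star p ** p - w]. *)
Lemma exists_norm_sq_le (p w : A) (e : R[i]) : star w = w -> 0 < e ->
  exists r, `|p + p ** ((star p ** p - w) ** r)| ^+ 2 <= `|w| + e.
Proof.
move=> ws e0; set k := star p ** p - w.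
have ks : star k = k by rewrite starB starM starK ws.
(* The summand 1 keeps [M] invertible when [k] vanishes. The approximate unit is taken for [k]
   divided by [M], with tolerance [e / M]. *)
pose M := `|k| + 1; have M0 : 0 < M by rewrite ltr_wpDl.
have MM : M * M^-1 = 1 by rewrite divff// gt_eqF.
have Ms : (M^-1)^* = M^-1 by rewrite conj_Creal// realV gtr0_real.
pose k' := M^-1 *: k.
have k's : star k' = k' by rewrite starZ ks Ms.
have k'1 : `|k'| <= 1.
  rewrite normrZ normfV (ger0_norm (ltW M0)) ler_pdivrMl// mulr1.
  by rewrite lerDl.
have eM : 0 < e / M by rewrite divr_gt0.
have [g [gs g1 kg [r gr]]] := approximate_unit k's k'1 eM.
exists (M^-1 *: r).
have -> : p + p ** (k ** (M^-1 *: r)) = p ** g.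
  by rewrite gr bmulDr bmulx1 -bscalerAr bscalerAl.
rewrite -cstar_identity starM gs.
have -> : g ** star p ** (p ** g) = g ** (w ** g) + g ** (k ** g).
  by rewrite -bmulDr -bmulDl /k addrC subrK !bmulA.
rewrite (le_trans (ler_normD _ _))// lerD//.
  rewrite (le_trans (ler_norm_bmul _ _))// (le_trans (ler_piMl _ g1))//.
  by rewrite (le_trans (ler_norm_bmul _ _))// ler_piMr.
rewrite (le_trans (ler_norm_bmul _ _))// (le_trans (ler_piMl _ g1))//.
have -> : k ** g = M *: (k' ** g) by rewrite bscalerAl scalerA MM scale1r.
by rewrite normrZ (ger0_norm (ltW M0)) mulrC -ler_pdivlMr.
Qed.

End CStarEstimates.

(** Formulated for an arbitrary class on [T], so that the enriched structure keeps the carrier [T]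
    and its norm. *)
Definition star_pack (R : realType) (T : Type)
    (c : BanachAlgebra.axioms_ R[i] T)
    (B := BanachAlgebra.Pack c) (st : B -> B)
    (stK : involutive st) (stD : {morph st : x y / x + y})
    (stZ : forall (k : R[i]) x, st (k *: x) = k^* *: st x)
    (stM : forall x y, st (x ** y) = st y ** st x)
    (st_norm : forall x, `|st x| = `|x|) : banachStarAlgType R[i] :=
  HB.pack T B (hasIsometricInvolution.Build R[i] B stK stD stZ stM st_norm).

Definition cstar_pack (R : realType) (T : Type)
    (c : BanachStarAlgebra.axioms_ R[i] T)
    (B := BanachStarAlgebra.Pack c)
    (cstarB : forall x : B, `|star x ** x| = `|x| ^+ 2) : cstarAlgType R[i] :=
  HB.pack T B (isCStarAlgebra.Build R[i] B cstarB).

(** * The C*-structure induced on a contractively split quotient *)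

Section CStarQuotient.
Variables (R : realType) (A : cstarAlgType R[i]).
Variable X : completeNormedModType R[i].
Variables (a : A -> X) (s : X -> A).
Hypothesis a_linear : linear a.
Hypothesis sK : cancel s a.
Hypothesis a_contr : forall x, `|a x| <= `|x|.
Hypothesis s_contr : forall x, `|s x| <= `|x|.
Hypothesis aM : forall x y, a (x ** y) = a (s (a x) ** s (a y)).
Hypothesis aS : forall x, a (star x) = a (star (s (a x))).

Let aD x y : a (x + y) = a x + a y.
Proof. by have := a_linear 1 x y; rewrite !scale1r. Qed.
Let a0 : a 0 = 0.
Proof. by apply: (addrI (a 0)); rewrite -aD !addr0. Qed.
Let aZ k x : a (k *: x) = k *: a x.
Proof. by have := a_linear k x 0; rewrite a0 !addr0. Qed.
Let aN x : a (- x) = - a x.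
Proof. by rewrite -scaleN1r aZ scaleN1r. Qed.

(** The operations are computed on the chosen lifts [s x]. By [qmulE] and [qstarE] any other lifts
    give the same result, so the axioms transfer from [A]. *)
Let qmul x y := a (s x ** s y).
Let qstar x := a (star (s x)).
Let qmulE x y : qmul (a x) (a y) = a (x ** y). Proof. by rewrite [RHS]aM. Qed.
Let qstarE x : qstar (a x) = a (star x). Proof. by rewrite [RHS]aS. Qed.

Let qmulA : associative qmul.
Proof.
by move=> x y z; rewrite -(sK x) -(sK y) -(sK z) !qmulE bmulA.
Qed.
Let qmul1x : left_id (a bone) qmul.
Proof. by move=> x; rewrite -(sK x) qmulE bmul1x. Qed.
Let qmulx1 : right_id (a bone) qmul.
Proof. by move=> x; rewrite -(sK x) qmulE bmulx1. Qed.
Let qmulDl : left_distributive qmul +%R.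
Proof.
by move=> x y z; rewrite -(sK x) -(sK y) -(sK z) -aD !qmulE -aD bmulDl.
Qed.
Let qmulDr : right_distributive qmul +%R.
Proof.
by move=> x y z; rewrite -(sK x) -(sK y) -(sK z) -aD !qmulE -aD bmulDr.
Qed.
Let qscalerAl k x y : k *: qmul x y = qmul (k *: x) y.
Proof. by rewrite -(sK x) -(sK y) !qmulE -!aZ !qmulE bscalerAl. Qed.
Let qscalerAr k x y : k *: qmul x y = qmul x (k *: y).
Proof. by rewrite -(sK x) -(sK y) !qmulE -!aZ !qmulE bscalerAr. Qed.
Let qnormM x y : `|qmul x y| <= `|x| * `|y|.
Proof.
by rewrite (le_trans (a_contr _))// (le_trans (ler_norm_bmul _ _))// ler_pM.
Qed.
Let qnorm1 : `|a bone| <= 1.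
Proof. by rewrite (le_trans (a_contr _))// ler_norm_bone. Qed.

Let Qalg : banachAlgType R[i] :=
  HB.pack (X : Type) X (isBanachAlgebra.Build R[i] X qmulA qmul1x qmulx1 qmulDl
    qmulDr qscalerAl qscalerAr qnormM qnorm1).

Let qstarK : involutive qstar.
Proof. by move=> x; rewrite -(sK x) !qstarE starK. Qed.
Let qstarD : {morph qstar : x y / x + y}.
Proof. by move=> x y; rewrite -(sK x) -(sK y) !qstarE -!aD !qstarE starD. Qed.
Let qstarZ k x : qstar (k *: x) = k^* *: qstar x.
Proof. by rewrite -(sK x) !qstarE -!aZ !qstarE starZ. Qed.
Let qstarM x y : qstar (qmul x y) = qmul (qstar y) (qstar x).
Proof. by rewrite -(sK x) -(sK y) !(qmulE, qstarE) starM. Qed.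
Let qstar_le x : `|qstar x| <= `|x|.
Proof. by rewrite (le_trans (a_contr _))// norm_star. Qed.
Let qnorm_star x : `|qstar x| = `|x|.
Proof.
by apply/eqP; rewrite eq_le qstar_le/= -{1}(qstarK x) qstar_le.
Qed.

Let Qstar : banachStarAlgType R[i] :=
  @star_pack _ X (BanachAlgebra.class Qalg) qstar qstarK qstarD qstarZ
    qstarM qnorm_star.

Let qcstar (x : X) : `|qmul (qstar x) x| = `|x| ^+ 2.
Proof.
apply/eqP; rewrite eq_le; apply/andP; split.
  by rewrite (le_trans (qnormM _ _))// qnorm_star.
have nr : `|qmul (qstar x) x| \is Num.real by exact: normr_real.
apply/ler_addgt0Pr => e e0; set h := qmul (qstar x) x.
have hs : qstar h = h by rewrite /h qstarM qstarK.
(* The lift [s h] need not be self-adjoint, but its real part is. It still lies over [h], which is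
   self-adjoint, and its norm is no larger. *)
pose w := 2^-1 *: (s h + star (s h)).
have half : `|2^-1 : R[i]| = 2^-1 by rewrite ger0_norm// invr_ge0.
have ws : star w = w.
  by rewrite starZ starD starK addrC fmorphV rmorph_nat.
have aw : a w = h.
  rewrite aZ aD -qstarE sK hs.
  have -> : h + h = 2 *: h by rewrite scaler_nat mulr2n.
  by rewrite scalerA mulVf ?scale1r// pnatr_eq0.
have w1 : `|w| <= `|h|.
  rewrite normrZ half ler_pdivrMl// (le_trans (ler_normD _ _))//.
  by rewrite norm_star mulr_natl mulr2n lerD.
have [r Hr] := exists_norm_sq_le (s x) ws e0.
have qmul0 y : qmul 0 y = 0.
  rewrite -a0 -(sK y). by rewrite qmulE bmul0x.
have qmulr0 y : qmul y 0 = 0.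
  by rewrite -a0 -(sK y) qmulE bmulx0.
(* The correction term dies under [a], because [star (s x) ** s x] and [w] both lie over [h]. So the
   short element found above is another lift of [x], and [a] is contractive. *)
have ax : a (s x + s x ** ((star (s x) ** s x - w) ** r)) = x.
  rewrite aD sK -[X in _ + X]qmulE -[X in qmul _ X]qmulE.
  rewrite aD aN aw -[X in X - _]qmulE -qstarE sK subrr qmul0.
  by rewrite qmulr0 addr0.
rewrite -{1}ax; apply: le_trans (_ : `|w| + e <= _); last by rewrite lerD2r.
by apply: le_trans Hr; rewrite ler_pXn2r ?nnegrE.
Qed.

Let Q : cstarAlgType R[i] :=
  @cstar_pack _ X (BanachStarAlgebra.class Qstar) qcstar.

(** The witness is [X] itself with the induced operations. The mutually inverse [phi] and [psi] are
    identities there; they stand for the equality of carriers, which is lost once [Q] is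
    existentially quantified. *)
Lemma cstar_quotient :
  exists (Q : cstarAlgType R[i]) (h : A -> Q) (phi : Q -> X) (psi : X -> Q),
    cstar_mor h /\ [/\ ban_mor phi, ban_mor psi, cancel phi psi,
      cancel psi phi & phi \o h = a].
Proof.
exists Q, (a : A -> Q), id, id; split; last by split.
by split=> // [x y|x]; rewrite -?qmulE -?qstarE.
Qed.

End CStarQuotient.

(** * Free C*-algebras *)

Lemma linear_subr (K : pzRingType) (U V : lmodType K) (f : U -> V) :
  linear f -> forall x y, f (x - y) = f x - f y.
Proof.
by move=> fl x y; rewrite -scaleN1r addrC fl scaleN1r addrC.
Qed.

(** * Limits of sequences in normed spaces and sequential completeness *)

Section NormLimits.
Variable R : realType.
Implicit Types (V W : completeNormedModType R[i]).

Definition tends (V : normedModType R[i]) (u : nat -> V) (l : V) : Prop :=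
  forall e : R[i], 0 < e -> exists N, forall n, (N <= n)%N -> `|l - u n| <= e.

Definition ncauchy (V : normedModType R[i]) (u : nat -> V) : Prop :=
  forall e : R[i], 0 < e -> exists N, forall m n,
    (N <= m)%N -> (N <= n)%N -> `|u m - u n| <= e.

(** The default 0 for divergent sequences makes [eval] total; under a representation, good terms
    never reach it. *)
Definition nlim (V : normedModType R[i]) (u : nat -> V) : V :=
  xget 0 [set l | tends u l].

Lemma tends_unique (V : normedModType R[i]) (u : nat -> V) (l l' : V) :
  tends u l -> tends u l' -> l = l'.
Proof.
move=> ul ul'; apply/eqP; rewrite -subr_eq0; apply/eqP.
apply: (@eq0_norm_small _ _ _ 2) => // e e0 _.
have [N HN] := ul _ e0; have [N' HN'] := ul' _ e0.
rewrite -(subrKA (u (maxn N N'))) (le_trans (ler_normD _ _))//.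
rewrite mulr_natl mulr2n lerD ?HN ?leq_maxl//.
by rewrite distrC HN' ?leq_maxr.
Qed.

Lemma tends_lim (V : normedModType R[i]) (u : nat -> V) (l : V) :
  tends u l -> nlim u = l.
Proof.
move=> ul; apply: (@tends_unique _ u) => //.
exact: (xgetPex 0 (ex_intro _ l ul)).
Qed.

Lemma tends_norm_le (V : normedModType R[i]) (u : nat -> V) (l : V)
    (M : R[i]) N :
  tends u l -> (forall n, (N <= n)%N -> `|u n| <= M) -> `|l| <= M.
Proof.
move=> ul uM; have lr : `|l| \is Num.real by exact: normr_real.
have Mr : M \is Num.real by apply: ger0_real; apply: le_trans (uM N _).
apply/ler_addgt0Pr => e e0; have [N' HN'] := ul _ e0.
have := leq_maxl N N'; have := leq_maxr N N'; set n := maxn N N' => n2 n1.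
by rewrite -(subrK (u n) l) (le_trans (ler_normD _ _))// addrC lerD ?uM ?HN'.
Qed.

Lemma tends_dist_le (V : normedModType R[i]) (u : nat -> V) (l x : V)
    (M : R[i]) N :
  tends u l -> (forall n, (N <= n)%N -> `|u n - x| <= M) -> `|l - x| <= M.
Proof.
move=> ul; apply: tends_norm_le => e e0; have [N' HN'] := ul e e0.
by exists N' => n nN; rewrite opprB addrA subrK HN'.
Qed.

Lemma ban_mor_tends V W (h : V -> W) (u : nat -> V) (l : V) :
  ban_mor h -> tends u l -> tends (h \o u) (h l).
Proof.
move=> [hl hn] ul e e0; have [N HN] := ul _ e0; exists N => n nN /=.
rewrite -(linear_subr hl).
exact: le_trans (hn _) (HN _ nN).
Qed.

Lemma inv_nat_lt (e : R[i]) : 0 < e -> exists N, N.+1%:R^-1 < e.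
Proof.
move=> e0; have eE : e = (complex.Re e)%:C%C by rewrite RRe_real // gtr0_real.
have e0' : 0 < complex.Re e by move: e0; rewrite {1}eE ltcR.
have [N HN] : exists N, (complex.Re e)^-1 < N%:R.
  by eexists; apply: archi_boundP; rewrite invr_ge0 ltW.
exists N; rewrite eE.
have -> : N.+1%:R^-1 = (N.+1%:R^-1 : R)%:C%C :> R[i].
  by rewrite fmorphV rmorph_nat.
rewrite ltcR invf_plt ?posrE// (lt_trans HN)// ltr_nat//.
Qed.

Lemma ncauchy_tends V (u : nat -> V) : ncauchy u -> tends u (nlim u).
Proof.
move=> uc.
suff [l ul] : exists l, tends u l by rewrite (tends_lim ul).
suff /cauchy_cvg/cvg_ex[l /cvgrPdist_le ul] : cauchy (u @ \oo).
  by exists l => e e0; have [N _ HN] := ul _ e0; exists N => n; exact: HN.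
apply/cauchy_exP => e e0.
have e20 : 0 < e / 2 by rewrite divr_gt0.
have [N HN] := uc _ e20; exists (u N); exists N => // n /= Nn.
rewrite -ball_normE /= (le_lt_trans (HN _ _ (leqnn N) Nn))//.
by rewrite ltr_pdivrMr// mulr_natr mulr2n ltrDl.
Qed.

(** The filter contains a ball of radius [n.+1%:R^-1] around some [u n]. Two members of a proper
    filter meet, so [u] is Cauchy, and the filter converges to its limit. *)
Lemma seq_complete (V : normedModType R[i]) :
  (forall u : nat -> V, ncauchy u -> exists l, tends u l) ->
  forall F : set_system V, ProperFilter F -> cauchy F -> cvg F.
Proof.
move=> Vc F FF /cauchyP Fc.
have d0 n : 0 < n.+1%:R^-1 :> R[i] by rewrite invr_gt0.
have {Fc} /choice[u Fu] : forall n, exists x, F (ball x n.+1%:R^-1).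
  by move=> n; exact: (Fc _ (d0 n)).
have dist m n : `|u m - u n| <= m.+1%:R^-1 + n.+1%:R^-1.
  have [x [mx nx]] := filter_ex (filterI (Fu m) (Fu n)).
  rewrite -(subrKA x) (le_trans (ler_normD _ _))// lerD//.
    by apply: ltW; move: mx; rewrite -ball_normE.
  by rewrite distrC; apply: ltW; move: nx; rewrite -ball_normE.
have small e : 0 < e ->
    exists N, forall n, (N <= n)%N -> n.+1%:R^-1 <= e / 2 :> R[i].
  move=> e0; have [N HN] : exists N, N.+1%:R^-1 < e / 2.
    by apply: inv_nat_lt; rewrite divr_gt0.
  exists N => n nN; rewrite (le_trans _ (ltW HN))// lef_pV2 ?posrE//.
  by rewrite ler_nat.
have [|l ul] := Vc u.
  move=> e e0; have [N HN] := small e e0; exists N => m n Nm Nn.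
  by rewrite (le_trans (dist m n))// [leRHS]splitr lerD ?HN.
apply/cvg_ex; exists l; apply/cvgrPdist_le => e e0.
have e20 : 0 < e / 2 by rewrite divr_gt0.
have [N HN] := small e e0; have [N' HN'] := ul _ e20.
have := leq_maxl N N'; have := leq_maxr N N'; set n := maxn N N' => n2 n1.
apply: filterS (Fu n) => x; rewrite -ball_normE /= => ux.
rewrite -(subrKA (u n)) (le_trans (ler_normD _ _))// [leRHS]splitr lerD ?HN'//.
by rewrite (le_trans (ltW ux))// HN.
Qed.

End NormLimits.

(** All expressions live in one type, fixed before any algebra is chosen, so ranging over all
    representations raises no question of size. *)
Inductive cterm (K X : Type) : Type :=
| Gen of X
| One
| Add of cterm K X & cterm K X
| Scale of K & cterm K X
| Mul of cterm K X & cterm K X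
| Star of cterm K X
| Lim of (nat -> cterm K X).
Arguments Gen {K X}. Arguments One {K X}.

HB.instance Definition _ (K X : Type) := gen_eqMixin (cterm K X).
HB.instance Definition _ (K X : Type) := gen_choiceMixin (cterm K X).

(* [g] exhibits [B] as an isometric subalgebra of a product of
   representations. *)
Definition jointly_isometric (R : realType) (X : Type)
    (Rep : forall A : cstarAlgType R[i], (X -> A) -> Prop)
    (B : cstarAlgType R[i]) (g : X -> B) : Prop :=
  forall (b : B) (r : R[i]), 0 <= r ->
    (forall (A : cstarAlgType R[i]) (p : B -> A),
       cstar_mor p -> Rep A (p \o g) -> `|p b| <= r) -> `|b| <= r.

(** * Formal expressions, their evaluations, and the universal algebra *)

Section FreeCStar.
Variables (R : realType) (X : Type).
Local Notation C := R[i].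
Local Notation term := (cterm C X).

Fixpoint eval (A : cstarAlgType C) (f : X -> A) (t : term) : A :=
  match t with
  | Gen x => f x
  | One => bone
  | Add t1 t2 => eval f t1 + eval f t2
  | Scale k t1 => k *: eval f t1
  | Mul t1 t2 => eval f t1 ** eval f t2
  | Star t1 => star (eval f t1)
  | Lim u => nlim (fun n => eval f (u n))
  end.

Variable Rep : forall A : cstarAlgType C, (X -> A) -> Prop.
Variable bnd : X -> C.
Hypothesis bnd_ge0 : forall x, 0 <= bnd x.
Hypothesis Rep_bnd : forall A f x, @Rep A f -> `|f x| <= bnd x.

(** One index [N] serves all representations: this is the Cauchy condition for the supremum of the
    evaluated seminorms. *)
Definition uniformly_cauchy (u : nat -> term) : Prop :=
  forall e : C, 0 < e -> exists N, forall m n, (N <= m)%N -> (N <= n)%N ->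
    forall (A : cstarAlgType C) (f : X -> A), Rep f ->
      `|eval f (u m) - eval f (u n)| <= e.

Fixpoint good (t : term) : Prop :=
  match t with
  | Gen _ | One => True
  | Add t1 t2 | Mul t1 t2 => good t1 /\ good t2
  | Scale _ t1 | Star t1 => good t1
  | Lim u => (forall n, good (u n)) /\ uniformly_cauchy u
  end.

Lemma eval_tends u (A : cstarAlgType C) (f : X -> A) :
  Rep f -> uniformly_cauchy u ->
  tends (fun n => eval f (u n)) (eval f (Lim u)).
Proof.
move=> Rf uc; apply: ncauchy_tends => e e0.
by have [N HN] := uc e e0; exists N => m n Nm Nn; exact: HN.
Qed.

(** Makes the supremum norm finite. At [Lim], all late approximants are uniformly within 1 of a
    fixed one, which is bounded by induction. *)
Lemma good_bounded t : good t ->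
  exists2 M : C, 0 <= M &
    forall (A : cstarAlgType C) (f : X -> A), Rep f -> `|eval f t| <= M.
Proof.
elim: t => [x|||k|||].
- by move=> _; exists (bnd x) => // A f; exact: Rep_bnd.
- by move=> _; exists 1 => // A f _; exact: ler_norm_bone.
- move=> t1 IH1 t2 IH2 /= [/IH1[M1 M10 H1] /IH2[M2 M20 H2]].
  exists (M1 + M2) => [|A f Rf]; first exact: addr_ge0.
  by rewrite (le_trans (ler_normD _ _))// lerD ?H1 ?H2.
- move=> t IH /= /IH[M M0 H]; exists (`|k| * M) => [|A f Rf].
    by rewrite mulr_ge0.
  by rewrite normrZ ler_wpM2l// H.
- move=> t1 IH1 t2 IH2 /= [/IH1[M1 M10 H1] /IH2[M2 M20 H2]].
  exists (M1 * M2) => [|A f Rf]; first exact: mulr_ge0.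
  by rewrite (le_trans (ler_norm_bmul _ _))// ler_pM ?H1 ?H2.
- move=> t IH /= /IH[M M0 H]; exists M => // A f Rf.
  by rewrite norm_star H.
- move=> u IH [/= gu uc]; have [N HN] := uc 1 ltr01.
  have [M M0 H] := IH N (gu N).
  exists (M + 1) => [|A f Rf]; first by rewrite addr_ge0.
  apply: (tends_norm_le (N := N) (eval_tends Rf uc)) => n Nn.
  rewrite -(subrK (eval f (u N)) (eval f (u n))) addrC.
  rewrite (le_trans (ler_normD _ _))//.
  by apply: lerD; [exact: H|exact: HN].
Qed.

(** The case [Lim] holds because *-homomorphisms are contractive. Goodness matters there: [h] could
    turn a divergent sequence into a convergent one. *)
Lemma eval_comp (A B : cstarAlgType C) (h : A -> B) (f : X -> A) t :
  cstar_mor h -> Rep f -> good t ->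
  eval (h \o f) t = h (eval f t).
Proof.
move=> hm Rf; have [hl h1 hM hS] := hm.
have h0 : h 0 = 0 by have := hl (-1) 0 0; rewrite scaler0 addr0 scaleN1r addNr.
have hD a b : h (a + b) = h a + h b by have := hl 1 a b; rewrite !scale1r.
have hZ k a : h (k *: a) = k *: h a by have := hl k a 0; rewrite h0 !addr0.
elim: t => [x|||k|||] //=.
- by move=> t1 IH1 t2 IH2 [/IH1-> /IH2->].
- by move=> t IH /IH->.
- by move=> t1 IH1 t2 IH2 [/IH1-> /IH2->].
- by move=> t IH /IH->.
- move=> u IH [gu uc]; apply: tends_lim.
  have := ban_mor_tends (cstar_mor_ban hm) (eval_tends Rf uc).
  by congr tends; apply/funext => n /=; rewrite IH.
Qed.

Definition eval_eq (t t' : term) : Prop :=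
  forall (A : cstarAlgType C) (f : X -> A), Rep f -> eval f t = eval f t'.

Definition canon (t : term) : term :=
  xget One [set t' | good t' /\ eval_eq t' t].

Lemma canonP t : good t -> good (canon t) /\ eval_eq (canon t) t.
Proof. by move=> gt; rewrite /canon; case: xgetP => // /(_ t)[]. Qed.

Lemma canon_eq t t' : eval_eq t t' -> canon t = canon t'.
Proof.
move=> tt'; congr xget; apply/seteqP; split=> u /= [gu ut]; split=> // A f Rf.
  by rewrite ut ?tt'.
by rewrite ut ?tt'.
Qed.

Lemma canon_fix t : good t -> good (canon t) /\ canon (canon t) = canon t.
Proof. by move=> gt; have [? /canon_eq] := canonP gt. Qed.

(* Elements are canonical representatives of the good terms modulo equality of
   all evaluations; the constructor [Lim] makes the result complete. *)
Definition free_carrier : Type := {t : term | good t /\ canon t = t}.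
Implicit Types q : free_carrier.

Definition cls t (gt : good t) : free_carrier :=
  exist _ (canon t) (canon_fix gt).
Definition ev (A : cstarAlgType C) (f : X -> A) q : A := eval f (sval q).

Lemma ev_cls (A : cstarAlgType C) (f : X -> A) t (gt :
  good t) : Rep f -> ev f (cls gt) = eval f t.
Proof. by move=> Rf; have [_] := canonP gt; apply. Qed.

(** The canonical term depends only on the evaluations. This reduces every law of the free algebra
    to the same law in each [A]. *)
Lemma ev_inj q q' :
  (forall (A : cstarAlgType C) (f : X -> A), Rep f -> ev f q = ev f q') ->
  q = q'.
Proof.
move=> H; apply: eq_sig_hprop; first by move=> ? ? ?; exact: Prop_irrelevance.
case: q q' H => [t [gt ct]] [t' [gt' ct']] H /=.
by rewrite -ct -ct'; exact: canon_eq.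
Qed.

Lemma good_sval q : good (sval q). Proof. by case: q => t []. Qed.

Definition fzero := @cls (Scale 0 One) I.
Definition fone := @cls One I.
Definition fgen x := @cls (Gen x) I.
Definition fadd q q' :=
  @cls (Add (sval q) (sval q')) (conj (good_sval q) (good_sval q')).
Definition fmul q q' :=
  @cls (Mul (sval q) (sval q')) (conj (good_sval q) (good_sval q')).
Definition fscale k q := @cls (Scale k (sval q)) (good_sval q).
Definition fstar q := @cls (Star (sval q)) (good_sval q).
Definition fopp q := fscale (-1) q.

Lemma ev0 (A : cstarAlgType C) (f : X -> A) : Rep f -> ev f fzero = 0.
Proof. by move=> Rf; rewrite ev_cls//= scale0r. Qed.
Lemma ev1 (A : cstarAlgType C) (f : X -> A) : Rep f -> ev f fone = bone.
Proof. by move=> Rf; rewrite ev_cls. Qed.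
Lemma ev_gen (A : cstarAlgType C) (f : X -> A) x : Rep f -> ev f (fgen x) = f x.
Proof. by move=> Rf; rewrite ev_cls. Qed.
Lemma evD (A : cstarAlgType C) (f : X -> A) q q' :
  Rep f -> ev f (fadd q q') = ev f q + ev f q'.
Proof. by move=> Rf; rewrite ev_cls. Qed.
Lemma evM (A : cstarAlgType C) (f : X -> A) q q' :
  Rep f -> ev f (fmul q q') = ev f q ** ev f q'.
Proof. by move=> Rf; rewrite ev_cls. Qed.
Lemma evZ (A : cstarAlgType C) (f : X -> A) k q :
  Rep f -> ev f (fscale k q) = k *: ev f q.
Proof. by move=> Rf; rewrite ev_cls. Qed.
Lemma evS (A : cstarAlgType C) (f : X -> A) q :
  Rep f -> ev f (fstar q) = star (ev f q).
Proof. by move=> Rf; rewrite ev_cls. Qed.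
Lemma evN (A : cstarAlgType C) (f : X -> A) q :
  Rep f -> ev f (fopp q) = - ev f q.
Proof. by move=> Rf; rewrite evZ// scaleN1r. Qed.

Definition evE := (ev0, ev1, evD, evM, evZ, evS, evN).

HB.instance Definition _ := gen_eqMixin free_carrier.
HB.instance Definition _ := gen_choiceMixin free_carrier.

Let faddA : associative fadd.
Proof. by move=> p q r; apply: ev_inj => A f Rf; rewrite !evE// addrA. Qed.
Let faddC : commutative fadd.
Proof. by move=> p q; apply: ev_inj => A f Rf; rewrite !evE// addrC. Qed.
Let fadd0 : left_id fzero fadd.
Proof. by move=> p; apply: ev_inj => A f Rf; rewrite !evE// add0r. Qed.
Let faddN : left_inverse fzero fopp fadd.
Proof. by move=> p; apply: ev_inj => A f Rf; rewrite !evE// addNr. Qed.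

HB.instance Definition _ :=
  GRing.isZmodule.Build free_carrier faddA faddC fadd0 faddN.

Let fscaleA a b q : fscale a (fscale b q) = fscale (a * b) q.
Proof. by apply: ev_inj => A f Rf; rewrite !evE// scalerA. Qed.
Let fscale1 : left_id 1 fscale.
Proof. by move=> q; apply: ev_inj => A f Rf; rewrite !evE// scale1r. Qed.
Let fscaleDr : right_distributive fscale +%R.
Proof. by move=> k p q; apply: ev_inj => A f Rf; rewrite !evE// scalerDr. Qed.
Let fscaleDl q : {morph fscale^~ q : a b / a + b}.
Proof. by move=> a b; apply: ev_inj => A f Rf; rewrite !evE// scalerDl. Qed.

HB.instance Definition _ := GRing.Zmodule_isLmodule.Build C free_carrier
  fscaleA fscale1 fscaleDr fscaleDl.

(** The element 0 keeps the set nonempty when [Rep] has no instance. The supremum is formed in [R]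
    and then embedded, since norms take values in [R[i]]. *)
Definition ev_norms q : set R :=
  [set r | r = 0 \/
    exists (A : cstarAlgType C) (f : X -> A), Rep f /\ r%:C%C = `|ev f q|].

Definition fnorm q : C := (sup (ev_norms q))%:C%C.

Lemma ge0_RRe (z : C) : 0 <= z -> z = (complex.Re z)%:C%C.
Proof. by move=> z0; rewrite RRe_real// ger0_real. Qed.

Lemma ev_norms_le q (M : C) : 0 <= M ->
  (forall (A : cstarAlgType C) (f : X -> A), Rep f -> `|ev f q| <= M) ->
  ubound (ev_norms q) (complex.Re M).
Proof.
move=> M0 HM r [->|[A [f [Rf rE]]]]; first by rewrite -lecR -ge0_RRe.
by rewrite -lecR -ge0_RRe// rE HM.
Qed.

Lemma fnorm_le q (M : C) : 0 <= M ->
  (forall (A : cstarAlgType C) (f : X -> A), Rep f -> `|ev f q| <= M) ->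
  fnorm q <= M.
Proof.
move=> M0 HM; rewrite (ge0_RRe M0) lecR; apply: ge_sup; first by exists 0; left.
exact: ev_norms_le.
Qed.

Let ev_norms_bounded q : has_ubound (ev_norms q).
Proof.
have [M M0 HM] := good_bounded (good_sval q).
by exists (complex.Re M); exact: ev_norms_le.
Qed.

Lemma fnorm_ge0 q : 0 <= fnorm q.
Proof. by rewrite ler0c; apply: ub_le_sup => //; left. Qed.

Lemma ev_le (A : cstarAlgType C) (f : X -> A) q : Rep f -> `|ev f q| <= fnorm q.
Proof.
move=> Rf; rewrite (ge0_RRe (normr_ge0 (ev f q))) lecR; apply: ub_le_sup => //.
by right; exists A, f; split=> //; rewrite -ge0_RRe.
Qed.

Let fnormD p q : fnorm (p + q) <= fnorm p + fnorm q.
Proof.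
apply: fnorm_le => [|A f Rf]; first by rewrite addr_ge0 ?fnorm_ge0.
by rewrite evD// (le_trans (ler_normD _ _))// lerD ?ev_le.
Qed.

Let fnormZ_le k q : fnorm (k *: q) <= `|k| * fnorm q.
Proof.
apply: fnorm_le => [|A f Rf]; first by rewrite mulr_ge0 ?fnorm_ge0.
by rewrite evZ// normrZ ler_wpM2l ?ev_le.
Qed.

Let fnormZ k q : fnorm (k *: q) = `|k| * fnorm q.
Proof.
apply/eqP; rewrite eq_le fnormZ_le /=; have [->|k0] := eqVneq k 0.
  by rewrite normr0 mul0r fnorm_ge0.
(* The reverse inequality is the same one for the scalar [k^-1] and the element [k *: q]. *)
have := fnormZ_le k^-1 (k *: q); rewrite scalerA mulVf// scale1r normfV.
by rewrite -ler_pdivlMl ?invr_gt0 ?normr_gt0// invrK.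
Qed.

Let fnorm_eq0 q : fnorm q = 0 -> q = 0.
Proof.
move=> q0; apply: ev_inj => A f Rf; rewrite ev0//; apply/eqP.
by rewrite -normr_le0 -q0 ev_le.
Qed.

HB.instance Definition _ := Lmodule_isNormed.Build C free_carrier
  fnormD fnormZ fnorm_eq0.

Let evB (A : cstarAlgType C) (f : X -> A) p q :
  Rep f -> ev f (p - q) = ev f p - ev f q.
Proof. by move=> Rf; rewrite evD// evN. Qed.

Let sval_uniformly_cauchy (u : nat -> free_carrier) : ncauchy u ->
  uniformly_cauchy (fun n => sval (u n)).
Proof.
move=> uc e e0; have [N HN] := uc e e0; exists N => m n Nm Nn A f Rf.
by rewrite -[X in `|X|]evB// (le_trans _ (HN _ _ Nm Nn))// ev_le.
Qed.

(** For fixed [n], the bound on the distance from [u m] to [u n] is uniform in [f] and survives the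
    limit in [m]. Completeness follows by applying this to representatives of a Cauchy sequence. *)
Lemma cls_Lim_tends (u : nat -> term) (gu : forall n, good (u n))
    (uc : uniformly_cauchy u) :
  tends (fun n => cls (gu n)) (@cls (Lim u) (conj gu uc)).
Proof.
move=> e e0; have [N HN] := uc e e0; exists N => n Nn.
apply: fnorm_le => [|A f Rf]; first exact: ltW.
rewrite evB// !ev_cls//.
apply: (tends_dist_le (N := N) (eval_tends Rf uc)) => m Nm.
exact: HN.
Qed.

Let cls_sval q : cls (good_sval q) = q.
Proof. by apply: ev_inj => A f Rf; rewrite ev_cls. Qed.

Let free_complete (F : set_system free_carrier) :
  ProperFilter F -> cauchy F -> cvg F.
Proof.
apply: seq_complete => u /sval_uniformly_cauchy uc.
have := cls_Lim_tends (fun n => good_sval (u n)) uc.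
by under eq_fun do rewrite cls_sval; eexists; eassumption.
Qed.

HB.instance Definition _ := Uniform_isComplete.Build free_carrier free_complete.

Let fmulA : associative fmul.
Proof. by move=> p q r; apply: ev_inj => A f Rf; rewrite !evE// bmulA. Qed.
Let fmul1x : left_id fone fmul.
Proof. by move=> p; apply: ev_inj => A f Rf; rewrite !evE// bmul1x. Qed.
Let fmulx1 : right_id fone fmul.
Proof. by move=> p; apply: ev_inj => A f Rf; rewrite !evE// bmulx1. Qed.
Let fmulDl : left_distributive fmul +%R.
Proof. by move=> p q r; apply: ev_inj => A f Rf; rewrite !evE// bmulDl. Qed.
Let fmulDr : right_distributive fmul +%R.
Proof. by move=> p q r; apply: ev_inj => A f Rf; rewrite !evE// bmulDr. Qed.
Let fscalerAl (k : C) q r : k *: fmul q r = fmul (k *: q) r.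
Proof. by apply: ev_inj => A f Rf; rewrite !evE// bscalerAl. Qed.
Let fscalerAr (k : C) q r : k *: fmul q r = fmul q (k *: r).
Proof. by apply: ev_inj => A f Rf; rewrite !evE// bscalerAr. Qed.
Let fnormM q r : `|fmul q r| <= `|q| * `|r|.
Proof.
apply: fnorm_le => [|A f Rf]; first by rewrite mulr_ge0.
by rewrite evM// (le_trans (ler_norm_bmul _ _))// ler_pM ?ev_le.
Qed.
Let fnorm1 : `|fone| <= 1.
Proof. by apply: fnorm_le => // A f Rf; rewrite ev1// ler_norm_bone. Qed.

HB.instance Definition _ := isBanachAlgebra.Build C free_carrier
  fmulA fmul1x fmulx1 fmulDl fmulDr fscalerAl fscalerAr fnormM fnorm1.

Let fstarK : involutive fstar.
Proof. by move=> q; apply: ev_inj => A f Rf; rewrite !evE// starK. Qed.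
Let fstarD : {morph fstar : x y / x + y}.
Proof. by move=> p q; apply: ev_inj => A f Rf; rewrite !evE// starD. Qed.
Let fstarZ (k : C) q : fstar (k *: q) = k^* *: fstar q.
Proof. by apply: ev_inj => A f Rf; rewrite !evE// starZ. Qed.
Let fstarM p q : fstar (p ** q) = fstar q ** fstar p.
Proof. by apply: ev_inj => A f Rf; rewrite !evE// starM. Qed.
Let fnorm_star_le q : `|fstar q| <= `|q|.
Proof. by apply: fnorm_le => // A f Rf; rewrite evS// norm_star ev_le. Qed.
Let fnorm_star q : `|fstar q| = `|q|.
Proof.
by apply/eqP; rewrite eq_le fnorm_star_le -{1}(fstarK q) fnorm_star_le.
Qed.

HB.instance Definition _ := hasIsometricInvolution.Build C free_carrier
  fstarK fstarD fstarZ fstarM fnorm_star.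

Let fcstar q : `|star q ** q| = `|q| ^+ 2.
Proof.
apply/eqP; rewrite eq_le; apply/andP; split.
  by rewrite (le_trans (ler_norm_bmul _ _))// norm_star.
(* Each [|ev f q| ^+ 2] is the norm of an evaluation of [star q ** q]. The square root turns this
   into a bound on [|ev f q|], as [fnorm_le] requires. *)
have nsq : 0 <= sqrtC `|star q ** q| by rewrite sqrtC_ge0.
rewrite -[leRHS]sqrtCK ler_pXn2r ?nnegrE//.
apply: fnorm_le => // A f Rf.
rewrite -(@ler_pXn2r _ 2)// ?nnegrE// sqrtCK -cstar_identity -evS// -evM//.
exact: ev_le.
Qed.

HB.instance Definition _ := isCStarAlgebra.Build C free_carrier fcstar.

Lemma ev_cstar_mor (A : cstarAlgType C) (f : X -> A) :
  Rep f -> cstar_mor (ev f).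
Proof.
move=> Rf; split=> [k p q||p q|p].
- by rewrite evD// evZ.
- exact: ev1.
- exact: evM.
- exact: evS.
Qed.

Hypothesis Rep_subdirect : forall (B : cstarAlgType C) (g : X -> B),
  jointly_isometric Rep g -> Rep g.

(** Every representation is an evaluation composed with [fgen], and the norm is the supremum over
    evaluations, so [fgen] is jointly isometric. *)
Lemma Rep_fgen : Rep fgen.
Proof.
apply: Rep_subdirect => q r r0 H; apply: fnorm_le => // A f Rf.
apply: H; first exact: ev_cstar_mor.
by have -> : ev f \o fgen = f by apply/funext => x /=; rewrite ev_gen.
Qed.

(** Every element is thus the value of its own term at the generators, which gives uniqueness of
    extensions: a *-homomorphism passes inside [eval] by [eval_comp]. *)
Lemma eval_fgen t (gt : good t) : eval fgen t = cls gt.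
Proof.
elim: t gt => [x|||k|||] /=.
- by case.
- by case.
- move=> t1 IH1 t2 IH2 gt; have [g1 g2] := gt; rewrite (IH1 g1) (IH2 g2).
  by apply: ev_inj => A f Rf; rewrite evD// !ev_cls.
- move=> t IH gt; rewrite (IH gt).
  by apply: ev_inj => A f Rf; rewrite evZ// !ev_cls.
- move=> t1 IH1 t2 IH2 gt; have [g1 g2] := gt; rewrite (IH1 g1) (IH2 g2).
  by apply: ev_inj => A f Rf; rewrite evM// !ev_cls.
- move=> t IH gt; rewrite (IH gt).
  by apply: ev_inj => A f Rf; rewrite evS// !ev_cls.
- move=> u IH gt; have [gu uc] := gt; apply: tends_lim.
  have -> : (fun n => eval fgen (u n)) = (fun n => cls (gu n)).
    by apply/funext => n; exact: IH.
  by rewrite (Prop_irrelevance gt (conj gu uc)); exact: cls_Lim_tends.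
Qed.

Lemma free_cstar : exists (F : cstarAlgType C) (eta : X -> F),
  [/\ Rep eta,
      forall (A : cstarAlgType C) (f : X -> A), Rep f ->
        exists2 g : F -> A, cstar_mor g & g \o eta = f &
      forall (A : cstarAlgType C) (g g' : F -> A),
        cstar_mor g -> cstar_mor g' -> g \o eta = g' \o eta -> g = g'].
Proof.
exists free_carrier, fgen; split; first exact: Rep_fgen.
  move=> A f Rf; exists (ev f); first exact: ev_cstar_mor.
  by apply/funext => x; exact: ev_gen.
move=> A g g' gm gm' gg'; apply/funext => q.
rewrite -(cls_sval q) -eval_fgen -!eval_comp ?gg'//; try exact: Rep_fgen;
  exact: good_sval.
Qed.

End FreeCStar.

(** * Beck's monadicity criterion *)

Local Open Scope cat_scope.

(** * Fully faithful, essentially surjective functors *)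

Section Equivalence.
Variables (C E : category) (K : functor C E).
Hypothesis faithful : forall a b (f g : hom a b), fmap K f = fmap K g -> f = g.
Hypothesis full : forall a b (u : hom (K a) (K b)), exists v, fmap K v = u.
Hypothesis eso : forall e : E, exists (c : C) (i : hom (K c) e), is_iso i.

Lemma equivalence_of_fully_faithful : is_equivalence K.
Proof.
have [pre preE] : {pre : forall a b, hom (K a) (K b) -> hom a b |
    forall a b u, fmap K (pre a b u) = u}.
  (* Here [boolp.cid] is the choice operator, whereas plain [cid] is an identity arrow. *)
  exists (fun a b u => projT1 (boolp.cid (full u))) => a b u.
  exact: (projT2 (boolp.cid (full u))).
pose isoT e := {c : C & {i : hom (K c) e & {j : hom e (K c) |
  j ∘ i = cid (K c) /\ i ∘ j = cid e}}}.
have ch e : isoT e.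
  have [c /boolp.cid[i /boolp.cid[j ij]]] := boolp.cid (eso e).
  by exists c, i, j.
pose r e := projT1 (ch e).
pose i e : hom (K (r e)) e := projT1 (projT2 (ch e)).
pose j e : hom e (K (r e)) := projT1 (projT2 (projT2 (ch e))).
have ji e : j e ∘ i e = cid (K (r e)).
  by rewrite /i /j /r; case: (ch e) => c [? [? []]].
have ij e : i e ∘ j e = cid e.
  by rewrite /i /j /r; case: (ch e) => c [? [? []]].
pose rmap a b (f : hom a b) := pre _ _ (j b ∘ f ∘ i a).
have rmap1 a : rmap _ _ (cid a) = cid (r a).
  by apply: faithful; rewrite preE fmap1 ccompf1 ji.
have rmapM a b c (g : hom b c) (f : hom a b) :
    rmap _ _ (g ∘ f) = rmap _ _ g ∘ rmap _ _ f.
  apply: faithful; rewrite fmapM !preE.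
  have -> : j c ∘ g ∘ i b ∘ (j b ∘ f ∘ i a) =
      j c ∘ g ∘ (i b ∘ j b) ∘ f ∘ i a.
    by rewrite !ccompA.
  by rewrite ij ccompf1 !ccompA.
pose G := Functor rmap1 rmapM.
exists G; split.
  pose alpha (c : C) : hom (G (K c)) c := pre _ _ (i (K c)).
  have nat a b (f : hom a b) : f ∘ alpha a = alpha b ∘ fmap G (fmap K f).
    apply: faithful; rewrite !fmapM !preE /= ?preE.
    by rewrite !ccompA ij ccomp1f.
  exists (@NatTrans _ _ (functor_comp G K) (functor_id C) alpha nat) => c.
  exists (pre _ _ (j (K c))); split; apply: faithful;
    by rewrite fmapM !preE fmap1 ?ji ?ij.
have nat a b (f : hom a b) : f ∘ i a = i b ∘ fmap K (fmap G f).
  by rewrite /= preE !ccompA ij ccomp1f.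
exists (@NatTrans _ _ (functor_comp K G) (functor_id E) i nat) => e.
by exists (j e); split; [exact: ji|exact: ij].
Qed.

End Equivalence.

(** * Left adjoints from universal arrows *)

Section UniversalArrows.
Variables (C D : category) (G : functor C D).

Definition universal (d : D) (c : C) (eta : hom d (G c)) : Prop :=
  (forall c' (f : hom d (G c')), exists g, fmap G g ∘ eta = f) /\
  (forall c' (g g' : hom c c'), fmap G g ∘ eta = fmap G g' ∘ eta -> g = g').

(** The counit is the extension of the identity of [G c]; every law is checked after composition
    with a universal arrow. *)
Lemma adjunction_of_universal :
  (forall d, exists c (eta : hom d (G c)), universal eta) ->
  exists F : functor D C, inhabited (adjunction F G).
Proof.
move=> U.
have ch d : {c : C & {eta : hom d (G c) | universal eta}}.
  by have [c /boolp.cid[eta Heta]] := boolp.cid (U d); exists c, eta.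
pose F0 d := projT1 (ch d).
pose eta d : hom d (G (F0 d)) := projT1 (projT2 (ch d)).
have etaU d : universal (eta d) by exact: (projT2 (projT2 (ch d))).
have [ext extE] : {ext : forall d c, hom d (G c) -> hom (F0 d) c |
    forall d c f, fmap G (ext d c f) ∘ eta d = f}.
  exists (fun d c f => projT1 (boolp.cid ((etaU d).1 c f))) => d c f.
  exact: (projT2 (boolp.cid ((etaU d).1 c f))).
have uniq d c (g g' : hom (F0 d) c) :
    fmap G g ∘ eta d = fmap G g' ∘ eta d -> g = g' by exact: (etaU d).2.
pose Fm a b (f : hom a b) := ext _ _ (eta b ∘ f).
have Fm1 a : Fm _ _ (cid a) = cid (F0 a).
  by apply: uniq; rewrite extE fmap1 ccomp1f ccompf1.
have FmM a b c (g : hom b c) (f : hom a b) :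
    Fm _ _ (g ∘ f) = Fm _ _ g ∘ Fm _ _ f.
  by apply: uniq; rewrite fmapM -ccompA !extE !ccompA extE.
pose F := Functor Fm1 FmM.
have unit_nat a b (f : hom a b) : fmap G (fmap F f) ∘ eta a = eta b ∘ f.
  by rewrite /= extE.
pose counit c : hom (F (G c)) c := ext _ _ (cid (G c)).
have counit_nat a b (f : hom a b) :
    f ∘ counit a = counit b ∘ fmap F (fmap G f).
  apply: uniq; rewrite !fmapM -!ccompA !extE ccompf1.
  by rewrite ccompA extE ccomp1f.
exists F; constructor.
apply: (@Adjunction _ _ F G
  (@NatTrans _ _ (functor_id D) (functor_comp G F) eta unit_nat)
  (@NatTrans _ _ (functor_comp F G) (functor_id C) counit counit_nat)).
- move=> d /=; apply: uniq.
  by rewrite fmapM -ccompA !extE ccompA extE ccomp1f fmap1 ccomp1f.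
- by move=> c /=; rewrite extE.
Qed.

End UniversalArrows.

Section Beck.
Variables (C D : category) (G : functor C D).
Hypothesis universal_arrow :
  forall d, exists c (eta : hom d (G c)), universal eta.
Hypothesis faithful : forall a b (f g : hom a b), fmap G f = fmap G g -> f = g.
Hypothesis full_on_split : forall (a b c d : C) (u : hom (G a) (G b))
  (p : hom c a) (q : hom d b) (w : hom c d) (s : hom (G a) (G c)),
  u ∘ fmap G p = fmap G q ∘ fmap G w -> fmap G p ∘ s = cid (G a) ->
  exists v, fmap G v = u.
Hypothesis split_coequalizer : forall (c c' : C) (X : D) (p q : hom c' c)
  (a : hom (G c) X) (s : hom X (G c)) (t : hom (G c) (G c')),
  a ∘ fmap G p = a ∘ fmap G q -> a ∘ s = cid X ->
  fmap G q ∘ t = cid (G c) -> fmap G p ∘ t = s ∘ a ->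
  exists (e : C) (h : hom c e) (phi : hom (G e) X),
    is_iso phi /\ phi ∘ fmap G h = a.

(** A variant of Beck's criterion for faithful [G]. No universal property is asked of the lift [e]:
    adjointness alone identifies its counit in terms of [h], which makes [phi] an isomorphism of
    algebras. *)
Theorem beck_monadic : monadic G.
Proof.
have [F [adj]] := adjunction_of_universal universal_arrow.
exists F, adj.
pose eta := adj_unit adj; pose eps := adj_counit adj.
have etaN a b (f : hom a b) : fmap G (fmap F f) ∘ eta a = eta b ∘ f.
  exact: (naturality (adj_unit adj) f).
have epsN a b (f : hom a b) : f ∘ eps a = eps b ∘ fmap F (fmap G f).
  exact: (naturality (adj_counit adj) f).
apply: equivalence_of_fully_faithful.
- by move=> a b f g fg; apply: faithful; exact: (congr1 (@em_fun _ _ _ _) fg).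
- move=> a b u.
  (* The arrows [p] and [q] are the counits at [a] and [b], [w] is [F] applied to [u], and the
     section is the unit at [G a]. *)
  have [v vE] := full_on_split (em_fun_struct u) (adj_triangleR adj a).
  by exists v; apply: em_hom_eq.
- move=> X.
  pose st : hom (G (F (em_carrier X))) (em_carrier X) := em_struct X.
  have st_assoc :
      st ∘ fmap G (fmap F st) = st ∘ fmap G (eps (F (em_carrier X))).
    exact: (em_assoc X).
  have st_unit : st ∘ eta (em_carrier X) = cid (em_carrier X).
    exact: (em_unit X).
  (* The pair consists of [fmap F st] and the counit at the free object; it is split by the units at
     [X] and at [G (F X)]. *)
  have [c [h [phi [[psi [psiphi phipsi]] phih]]]] := split_coequalizer st_assoc
    st_unit (adj_triangleR adj (F (em_carrier X))) (etaN _ _ st).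
  have hE : h ∘ fmap F phi = eps c.
    (* An arrow from [F (G c)] to [c] is the counit as soon as its transpose is the identity; [tr]
       computes this transpose. *)
    have tr : fmap G (h ∘ fmap F phi) ∘ eta (G c) = cid (G c).
      rewrite fmapM -ccompA etaN -[LHS]ccomp1f -psiphi -ccompA; congr (_ ∘ _).
      by rewrite !ccompA phih st_unit ccomp1f.
    rewrite -[RHS]ccompf1 -(fmap1 F) -tr (fmapM F) ccompA -epsN -!ccompA.
    by rewrite (adj_triangleL adj) ccompf1.
  have phiH : phi ∘ fmap G (eps c) = st ∘ fmap G (fmap F phi).
    by rewrite -hE fmapM ccompA phih.
  have psiH : psi ∘ st = fmap G (eps c) ∘ fmap G (fmap F psi).
    rewrite -[st]ccompf1 -(fmap1 G) -(fmap1 F) -phipsi (fmapM F) (fmapM G).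
    rewrite [st ∘ _]ccompA -phiH.
    by rewrite !ccompA psiphi ccomp1f.
  exists c, (@EMHom _ _ (comparison_obj adj c) X phi phiH),
    (@EMHom _ _ X (comparison_obj adj c) psi psiH).
  by split; exact: em_hom_eq.
Qed.

End Beck.

(** * The forgetful functors *)

Lemma cstar_mor_linear (R : realType) (A B : cstarAlgType R[i]) (f : A -> B) :
  cstar_mor f -> linear f.
Proof. by case. Qed.

Lemma cstar_mor_of_surjective (R : realType) (A B B' : cstarAlgType R[i])
    (p : A -> B) (r : A -> B') (v : B -> B') :
  cstar_mor p -> cstar_mor r -> (forall x, v (p x) = r x) ->
  (forall y, exists x, p x = y) -> cstar_mor v.
Proof.
move=> [pl p1 pM pS] [rl r1 rM rS] vp ps; split.
- move=> k y y'; have [x <-] := ps y; have [x' <-] := ps y'.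
  by rewrite -pl !vp rl.
- by rewrite -p1 vp r1.
- move=> y y'; have [x <-] := ps y; have [x' <-] := ps y'.
  by rewrite -pM !vp rM.
- by move=> y; have [x <-] := ps y; rewrite -pS !vp rS.
Qed.

(** * Closure of the classes of representations under joint isometries *)

Section Subdirect.
Variables (R : realType) (X : Type).
Variable Rep : forall A : cstarAlgType R[i], (X -> A) -> Prop.
Variables (B : cstarAlgType R[i]) (g : X -> B).
Hypothesis ji : jointly_isometric Rep g.

Lemma jointly_injective (b b' : B) :
  (forall (A : cstarAlgType R[i]) (p : B -> A),
     cstar_mor p -> Rep (p \o g) -> p b = p b') -> b = b'.
Proof.
move=> H; apply/eqP; rewrite -subr_eq0 -normr_le0; apply: ji => // A p pm Rp.
by rewrite (linear_subr (cstar_mor_linear pm)) (H _ _ pm Rp) subrr normr0.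
Qed.

Lemma jointly_isometricW
    (Rep' : forall A : cstarAlgType R[i], (X -> A) -> Prop) :
  (forall (A : cstarAlgType R[i]) (f : X -> A), Rep f -> Rep' A f) ->
  jointly_isometric Rep' g.
Proof.
by move=> RR b r r0 H; apply: ji => // A p pm Rp; apply: H => //; exact: RR.
Qed.

End Subdirect.

(** Linearity is tested after each [p], since these are jointly injective; contractivity is joint
    isometry with [r] the norm of [x]. *)
Lemma ban_mor_subdirect (R : realType) (X : completeNormedModType R[i])
    (B : cstarAlgType R[i]) (g : X -> B) :
  jointly_isometric (fun A => @ban_mor R[i] X A) g -> ban_mor g.
Proof.
move=> ji; split=> [k x y|x].
  apply: (jointly_injective ji) => A p [pl _ _ _] [fl _].
  by rewrite pl; exact: (fl k x y).
by apply: ji => // A p _ [_]; apply.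
Qed.

Lemma banalg_mor_subdirect (R : realType) (X : banachAlgType R[i])
    (B : cstarAlgType R[i]) (g : X -> B) :
  jointly_isometric (fun A => @banalg_mor R[i] X A) g -> banalg_mor g.
Proof.
move=> ji; have [gl gn] : ban_mor g.
  by apply/ban_mor_subdirect/(jointly_isometricW ji) => A f [].
split=> //.
  apply: (jointly_injective ji) => A p [_ p1 _ _] [_ f1 _ _].
  by rewrite p1; exact: f1.
move=> x y; apply: (jointly_injective ji) => A p [_ _ pM _] [_ _ fM _].
by rewrite pM; exact: (fM x y).
Qed.

Lemma banstaralg_mor_subdirect (R : realType) (X : banachStarAlgType R[i])
    (B : cstarAlgType R[i]) (g : X -> B) :
  jointly_isometric (fun A => @banstaralg_mor R[i] X A) g -> banstaralg_mor g.
Proof.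
move=> ji; have [gl g1 gM gn] : banalg_mor g.
  by apply/banalg_mor_subdirect/(jointly_isometricW ji) => A f [].
split=> // x; apply: (jointly_injective ji) => A p [_ _ _ pS] [_ _ _ fS _].
by rewrite pS; exact: (fS x).
Qed.

Section Inverse.
Variables (R : realType) (A Q : cstarAlgType R[i]).
Variables (h : A -> Q) (hm : cstar_mor h) (hs : forall y, exists x, h x = y).

(** As [h] is onto, [phi] inherits multiplicativity from [a], and the inverse [psi] inherits it from
    [phi]. *)
Lemma banalg_mor_quotient (X : banachAlgType R[i]) (a : A -> X) (phi : Q -> X)
    (psi : X -> Q) : banalg_mor a -> (forall x, a x = phi (h x)) ->
  ban_mor phi -> ban_mor psi -> cancel phi psi -> cancel psi phi ->
  banalg_mor phi /\ banalg_mor psi.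
Proof.
move=> [_ a1 aM _] aE [phil phin] [psil psin] phiK psiK.
have [_ h1 hM _] := hm.
have phi1 : phi bone = bone by rewrite -h1 -aE.
have phiM : {morph phi : x y / x ** y}.
  move=> x y; have [x' <-] := hs x; have [y' <-] := hs y.
  by rewrite -hM -!aE aM.
split; split=> //; first by rewrite -phi1.
by move=> x y; apply: (can_inj phiK); rewrite phiM !psiK.
Qed.

Lemma banstaralg_mor_quotient (X : banachStarAlgType R[i]) (a : A -> X)
    (phi : Q -> X) (psi : X -> Q) :
  banstaralg_mor a -> (forall x, a x = phi (h x)) ->
  ban_mor phi -> ban_mor psi -> cancel phi psi -> cancel psi phi ->
  banstaralg_mor phi /\ banstaralg_mor psi.
Proof.
move=> [al a1 aM aS an] aE phib psib phiK psiK; have [_ _ _ hS] := hm.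
have [] := @banalg_mor_quotient X a phi psi _ aE phib psib phiK psiK => //.
move=> [phil phi1 phiM phin] [psil psi1 psiM psin].
have phiS : {morph phi : x / star x}.
  by move=> x; have [x' <-] := hs x; rewrite -hS -!aE aS.
split; split=> //.
by move=> x; apply: (can_inj phiK); rewrite phiS !psiK.
Qed.

End Inverse.

(** * Free algebras and quotients, in general and in the commutative case *)

Section Classes.
Variables (R : realType) (O1 : Type) (U1 : O1 -> cstarAlgType R[i]).

(** Together with [has_quotients], this abstracts the source category, so that all C*-algebras and
    the commutative ones share one monadicity proof. The predicate [Rep] still ranges over arbitrary
    C*-algebras. *)
Definition has_free_algebras : Prop :=
  forall (X : Type) (Rep : forall A : cstarAlgType R[i], (X -> A) -> Prop)
    (bnd : X -> R[i]), (forall x, 0 <= bnd x) ->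
    (forall (A : cstarAlgType R[i]) (f : X -> A) x,
       Rep A f -> `|f x| <= bnd x) ->
    (forall (B : cstarAlgType R[i]) (g : X -> B),
       jointly_isometric Rep g -> Rep B g) ->
  exists (F : O1) (eta : X -> U1 F),
  [/\ Rep (U1 F) eta,
      forall (A : O1) (f : X -> U1 A), Rep (U1 A) f ->
        exists2 g : U1 F -> U1 A, cstar_mor g & g \o eta = f &
      forall (A : O1) (g g' : U1 F -> U1 A), cstar_mor g -> cstar_mor g' ->
        g \o eta = g' \o eta -> g = g'].

Definition has_quotients : Prop :=
  forall (A : O1) (X : completeNormedModType R[i]) (a : U1 A -> X)
    (s : X -> U1 A),
    ban_mor a -> cancel s a -> (forall x, `|s x| <= `|x|) ->
    (forall x y, a (x ** y) = a (s (a x) ** s (a y))) ->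
    (forall x, a (star x) = a (star (s (a x)))) ->
  exists (Q : O1) (h : U1 A -> U1 Q) (phi : U1 Q -> X) (psi : X -> U1 Q),
    cstar_mor h /\ [/\ ban_mor phi, ban_mor psi, cancel phi psi,
      cancel psi phi & phi \o h = a].

End Classes.

Lemma cstar_has_free_algebras (R : realType) :
  @has_free_algebras R (cstarAlgType R[i]) id.
Proof. by move=> X Rep bnd bnd0 Rb Rs; exact: (free_cstar bnd0 Rb Rs). Qed.

Lemma cstar_has_quotients (R : realType) :
  @has_quotients R (cstarAlgType R[i]) id.
Proof.
move=> A X a s [al an] sK sn aM aS.
exact: (cstar_quotient al sK an sn aM aS).
Qed.

(** An equality of bundled algebras, rather than an isomorphism, lets maps and their properties be
    transported by case analysis. *)
Lemma exists_comCstar (R : realType) (F : cstarAlgType R[i]) :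
  commutative (@bmul _ F) ->
  exists F' : comCstarAlgType R[i], (F' : cstarAlgType R[i]) = F.
Proof.
move=> FC.
pose F' : comCstarAlgType R[i] :=
  HB.pack (F : Type) F (isCommutativeBanachAlgebra.Build R[i] F FC).
(* Once [F] is destructed into its fields, the repacked structure reduces to it by computation. *)
by exists F'; case: F FC @F'.
Qed.

(** Commutativity of the target becomes part of the representation predicate. It passes along joint
    isometries, so the free algebra for [RepC] is itself commutative and no commutators have to be
    divided out. *)
Lemma comCstar_has_free_algebras (R : realType) :
  @has_free_algebras R (comCstarAlgType R[i]) (fun A => A).
Proof.
move=> X Rep bnd bnd0 Rb Rs.
pose RepC (A : cstarAlgType R[i]) (f : X -> A) :=
  commutative (@bmul _ A) /\ Rep A f.
have RbC (A : cstarAlgType R[i]) (f : X -> A) x : RepC A f -> `|f x| <= bnd x.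
  by case=> _; exact: Rb.
have RsC (B : cstarAlgType R[i]) (g : X -> B) :
    jointly_isometric RepC g -> RepC B g.
  move=> ji; split; last by apply/Rs/(jointly_isometricW ji) => A f [].
  move=> x y; apply: (jointly_injective ji) => A p [_ _ pM _] [AC _].
  by rewrite !pM AC.
have [F [eta [[FC Reta] ext uniq]]] := free_cstar bnd0 RbC RsC.
have [F' FF'] := exists_comCstar FC; case: _ / FF' in eta FC Reta ext uniq *.
exists F', eta; split=> // [A f Rf|A]; last exact: uniq.
by apply: ext; split=> //; exact: bmulC.
Qed.

Lemma comCstar_has_quotients (R : realType) :
  @has_quotients R (comCstarAlgType R[i]) (fun A => A).
Proof.
move=> A X a s [al an] sK sn aM aS.
have [Q [h [phi [psi [hm [phib psib phiK psiK phih]]]]]] :=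
  cstar_quotient al sK an sn aM aS.
have hs y : h (s (phi y)) = y.
  by apply: (can_inj phiK); have := congr1 (@^~ (s (phi y))) phih => /= ->.
have QC : commutative (@bmul _ Q).
  by move=> x y; have [_ _ hM _] := hm; rewrite -(hs x) -(hs y) -!hM bmulC.
have [Q' QQ'] := exists_comCstar QC.
case: _ / QQ' in h phi psi hm phib psib phiK psiK phih hs QC *.
by exists Q', h, phi, psi.
Qed.

(** * Monadicity of a forgetful functor with abstract source and target *)

Section ForgetfulMonadic.
Variable R : realType.
Variables (O1 : Type) (U1 : O1 -> cstarAlgType R[i]).
Hypothesis free1 : has_free_algebras U1.
Hypothesis quot1 : has_quotients U1.
Let C1 : category := @concrete_category O1 (fun A => U1 A)
  (fun A B f => @cstar_mor R[i] (U1 A) (U1 B) f)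
  (fun A => @cstar_mor_id R[i] (U1 A))
  (fun A B D => @cstar_mor_comp R[i] (U1 A) (U1 B) (U1 D)).

Variables (O2 : Type) (U2 : O2 -> completeNormedModType R[i]).
Variable mor2 : forall X Y : O2, (U2 X -> U2 Y) -> Prop.
Hypothesis mor2_id : forall X, @mor2 X X id.
Hypothesis mor2_comp : forall X Y Z (g : U2 Y -> U2 Z) (f : U2 X -> U2 Y),
  mor2 g -> mor2 f -> mor2 (g \o f).
Hypothesis mor2_ban : forall X Y (f : U2 X -> U2 Y), mor2 f -> ban_mor f.
Let C2 : category :=
  @concrete_category O2 (fun X => U2 X) mor2 mor2_id mor2_comp.

(* [into] and [out] are the identity in all uses; they replace the definitional
   equality of carriers, which cannot be stated for an abstract [G]. *)
Variable G : functor C1 C2.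
Variable into : forall A : O1, U1 A -> U2 (G A).
Variable out : forall A : O1, U2 (G A) -> U1 A.
Hypothesis into_ban : forall A, ban_mor (@into A).
Hypothesis out_ban : forall A, ban_mor (@out A).
Hypothesis intoK : forall A, cancel (@into A) (@out A).
Hypothesis outK : forall A, cancel (@out A) (@into A).
Hypothesis G_out : forall (A B : C1) (f : hom A B) x,
  out (sval (fmap G f) x) = sval f (out x).

(** In all uses this is the morphism condition of the target category, read for arbitrary
    C*-algebras [A] and not only for values of [G], as [has_free_algebras] demands. *)
Variable Rep : forall (X : O2) (A : cstarAlgType R[i]), (U2 X -> A) -> Prop.
Hypothesis Rep_ban : forall X A f, @Rep X A f -> ban_mor f.
Hypothesis Rep_subdirect : forall X (B : cstarAlgType R[i]) (g : U2 X -> B),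
  jointly_isometric (@Rep X) g -> Rep g.
Hypothesis Rep_out : forall (X : O2) (A : O1) (f : U2 X -> U2 (G A)),
  mor2 f -> Rep (@out A \o f).
Hypothesis Rep_into : forall (X : O2) (A : O1) (f : U2 X -> U1 A),
  Rep f -> mor2 (@into A \o f).
Hypothesis quotient2 : forall (A Q : O1) (X : O2) (a : U2 (G A) -> U2 X)
  (h : U1 A -> U1 Q) (phi : U1 Q -> U2 X) (psi : U2 X -> U1 Q),
  mor2 a -> cstar_mor h -> (forall y, exists x, h x = y) ->
  (forall x, a (into x) = phi (h x)) -> ban_mor phi -> ban_mor psi ->
  cancel phi psi -> cancel psi phi ->
  mor2 (phi \o @out Q) /\ mor2 (@into Q \o psi).

Let G_into (A B : C1) (f : hom A B) x :
  sval (fmap G f) (into x) = into (sval f x).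
Proof. by rewrite -[LHS]outK G_out intoK. Qed.

Let hom2E (X Y Z : C2) (g : hom Y Z) (f : hom X Y) x :
  sval (g ∘ f) x = sval g (sval f x).
Proof. by []. Qed.

Let universal_arrow2 (X : C2) :
  exists (F : C1) (eta : hom X (G F)), universal eta.
Proof.
have [|||F [eta [Reta ext uniq]]] := @free1 (U2 X) (@Rep X) (fun x => `|x|).
- by [].
- by move=> A f x /Rep_ban[].
- exact: Rep_subdirect.
exists F, (exist _ _ (Rep_into Reta)); split.
- move=> A f; have [g gm geta] := ext A _ (Rep_out (svalP f)).
  exists (exist _ g gm); apply: mor_hom_eq; apply/funext => x.
  have := congr1 (@^~ x) geta; rewrite hom2E /= G_into /= => ->.
  exact: outK.
- move=> A g g' gg'; apply: mor_hom_eq; apply: uniq; try exact: svalP.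
  apply/funext => x; apply: (can_inj (@intoK A)).
  have := congr1 (fun f => sval f x) gg'.
  by rewrite !hom2E /= !G_into.
Qed.

Let faithful2 (A B : C1) (f g : hom A B) : fmap G f = fmap G g -> f = g.
Proof.
move=> fg; apply: mor_hom_eq; apply/funext => x.
by apply: (can_inj (@intoK B)); rewrite -!G_into fg.
Qed.

(** The map [p] is onto because [fmap G p] has a section, and [v \o p] is the *-homomorphism
    [q \o w]. *)
Let full2 (a b c d : C1) (u : hom (G a) (G b)) (p : hom c a)
  (q : hom d b) (w : hom c d) (s : hom (G a) (G c)) :
  u ∘ fmap G p = fmap G q ∘ fmap G w -> fmap G p ∘ s = cid (G a) ->
  exists v, fmap G v = u.
Proof.
move=> upqw ps; pose v (x : U1 a) : U1 b := out (sval u (into x)).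
have vm : cstar_mor v.
  apply: (cstar_mor_of_surjective (svalP p)
    (cstar_mor_comp (svalP q) (svalP w))).
    move=> x; rewrite /v -G_into -hom2E upqw hom2E !G_into intoK //.
  move=> y; exists (out (sval s (into y))).
  by rewrite -G_out -hom2E ps /= intoK.
exists (exist _ v vm); apply: mor_hom_eq; apply/funext => x.
by rewrite -(outK x) G_into /= /v outK.
Qed.

Let split_coequalizer2 (c c' : C1) (X : C2) (p q : hom c' c)
  (a : hom (G c) X) (s : hom X (G c)) (t : hom (G c) (G c')) :
  a ∘ fmap G p = a ∘ fmap G q -> a ∘ s = cid X ->
  fmap G q ∘ t = cid (G c) -> fmap G p ∘ t = s ∘ a ->
  exists (e : C1) (h : hom c e) (phi : hom (G e) X),
    is_iso phi /\ phi ∘ fmap G h = a.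
Proof.
move=> apq as1 qt pt.
pose a' (x : U1 c) : U2 X := sval a (into x).
pose s' (x : U2 X) : U1 c := out (sval s x).
pose t' (x : U1 c) : U1 c' := out (sval t (into x)).
have [_ s_n] := mor2_ban (svalP s).
have [_ out_n] := out_ban c.
have qt' x : sval q (t' x) = x by rewrite /t' -G_out -hom2E qt /= intoK.
have pt' x : sval p (t' x) = s' (a' x) by rewrite /t' -G_out -hom2E pt.
have apq' z : a' (sval p z) = a' (sval q z).
  by rewrite /a' -!G_into -!hom2E apq.
have [_ _ pM pS] := svalP p; have [_ _ qM qS] := svalP q.
have sK : cancel s' a' by move=> x; rewrite /a' /s' outK -hom2E as1.
have a'b : ban_mor a' := ban_mor_comp (mor2_ban (svalP a)) (into_ban c).
have [|||Q [h [phi [psi [hm [phib psib phiK psiK phih]]]]]] := quot1 a'b sK.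
- by move=> x; exact: le_trans (out_n _) (s_n _).
(* Write [x] and [y] as images under [q] of [t' x] and [t' y]. Their product can be formed before
   applying [q], then [apq'] replaces [q] by [p], and [p] sends [t' x] to [s' (a' x)].
   Multiplicativity of [t'] is not assumed. *)
- by move=> x y; rewrite -{1}(qt' x) -{1}(qt' y) -qM -apq' pM !pt'.
- by move=> x; rewrite -{1}(qt' x) -qS -apq' pS !pt'.
have phihE x : phi (h x) = a' x by rewrite -phih.
have hs y : exists x, h x = y.
  by exists (s' (phi y)); apply: (can_inj phiK); rewrite phihE sK.
have [m1 m2] := quotient2 (svalP a) hm hs (fun x => esym (phihE x))
  phib psib phiK psiK.
exists Q, (exist _ h hm), (exist _ _ m1); split.
  exists (exist _ _ m2); split; apply: mor_hom_eq; apply/funext => x /=.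
    by rewrite phiK outK.
  by rewrite intoK psiK.
apply: mor_hom_eq; apply/funext => x; rewrite hom2E /= G_out /= phihE /a'.
by rewrite outK.
Qed.

Lemma forgetful_monadic : monadic G.
Proof.
exact: (beck_monadic universal_arrow2 faithful2 full2 split_coequalizer2).
Qed.

End ForgetfulMonadic.

Lemma banalg_mor_ban (K : numFieldType) (A B : banachAlgType K) (f : A -> B) :
  banalg_mor f -> ban_mor f.
Proof. by case. Qed.

Lemma banstaralg_mor_ban (K : numClosedFieldType) (A B : banachStarAlgType K)
  (f : A -> B) : banstaralg_mor f -> ban_mor f.
Proof. by case. Qed.

(** All six cases instantiate [forgetful_monadic] with identities for [into] and [out]. Beyond the
    choice of source, they differ in the closure of [Rep] under joint isometries and in lifting
    [phi] and [psi] to the target category, which is immediate for Banach spaces. *)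
Theorem corollary2p6 (R : realType) :
  (monadic (CStar1_to_BanAlgStar1 R) /\
   monadic (CStar1_to_BanAlg1 R) /\
   monadic (CStar1_to_Ban R)) /\
  (monadic (CStarc1_to_BanAlgStarc1 R) /\
   monadic (CStarc1_to_BanAlgc1 R) /\
   monadic (CStarc1_to_Ban R)).
Proof.
split; split; [|split| |split].
- exact: (@forgetful_monadic R _ id (@cstar_has_free_algebras R)
    (@cstar_has_quotients R)
    (banachStarAlgType R[i]) (fun A => A)
    (fun X Y f => @banstaralg_mor R[i] X Y f)
    (fun X => @banstaralg_mor_id R[i] X)
    (fun X Y Z => @banstaralg_mor_comp R[i] X Y Z)
    (fun X Y f => @banstaralg_mor_ban R[i] X Y f)
    (CStar1_to_BanAlgStar1 R) (fun A => id) (fun A => id)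
    (fun A => @ban_mor_id R[i] A) (fun A => @ban_mor_id R[i] A)
    (fun A _ => erefl) (fun A _ => erefl) (fun A B f _ => erefl)
    (fun X A f => @banstaralg_mor R[i] X A f)
    (fun X A f => @banstaralg_mor_ban R[i] X A f)
    (fun X => @banstaralg_mor_subdirect R X)
    (fun X A f H => H) (fun X A f H => H)
    (fun A Q X a h phi psi am hm hs =>
       @banstaralg_mor_quotient R A Q h hm hs X a phi psi am)).
- exact: (@forgetful_monadic R _ id (@cstar_has_free_algebras R)
    (@cstar_has_quotients R)
    (banachAlgType R[i]) (fun A => A)
    (fun X Y f => @banalg_mor R[i] X Y f)
    (fun X => @banalg_mor_id R[i] X)
    (fun X Y Z => @banalg_mor_comp R[i] X Y Z)
    (fun X Y f => @banalg_mor_ban R[i] X Y f)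
    (CStar1_to_BanAlg1 R) (fun A => id) (fun A => id)
    (fun A => @ban_mor_id R[i] A) (fun A => @ban_mor_id R[i] A)
    (fun A _ => erefl) (fun A _ => erefl) (fun A B f _ => erefl)
    (fun X A f => @banalg_mor R[i] X A f)
    (fun X A f => @banalg_mor_ban R[i] X A f)
    (fun X => @banalg_mor_subdirect R X)
    (fun X A f H => H) (fun X A f H => H)
    (fun A Q X a h phi psi am hm hs =>
       @banalg_mor_quotient R A Q h hm hs X a phi psi am)).
- exact: (@forgetful_monadic R _ id (@cstar_has_free_algebras R)
    (@cstar_has_quotients R)
    (completeNormedModType R[i]) (fun A => A)
    (fun X Y f => @ban_mor R[i] X Y f)
    (fun X => @ban_mor_id R[i] X)
    (fun X Y Z => @ban_mor_comp R[i] X Y Z)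
    (fun X Y f H => H)
    (CStar1_to_Ban R) (fun A => id) (fun A => id)
    (fun A => @ban_mor_id R[i] A) (fun A => @ban_mor_id R[i] A)
    (fun A _ => erefl) (fun A _ => erefl) (fun A B f _ => erefl)
    (fun X A f => @ban_mor R[i] X A f)
    (fun X A f H => H)
    (fun X => @ban_mor_subdirect R X)
    (fun X A f H => H) (fun X A f H => H)
    (fun A Q X a h phi psi _ _ _ _ phib psib _ _ => conj phib psib)).
- exact: (@forgetful_monadic R (comCstarAlgType R[i]) (fun A => A)
    (@comCstar_has_free_algebras R) (@comCstar_has_quotients R)
    (comBanachStarAlgType R[i]) (fun A => A)
    (fun X Y f => @banstaralg_mor R[i] X Y f)
    (fun X => @banstaralg_mor_id R[i] X)
    (fun X Y Z => @banstaralg_mor_comp R[i] X Y Z)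
    (fun X Y f => @banstaralg_mor_ban R[i] X Y f)
    (CStarc1_to_BanAlgStarc1 R) (fun A => id) (fun A => id)
    (fun A => @ban_mor_id R[i] A) (fun A => @ban_mor_id R[i] A)
    (fun A _ => erefl) (fun A _ => erefl) (fun A B f _ => erefl)
    (fun X A f => @banstaralg_mor R[i] X A f)
    (fun X A f => @banstaralg_mor_ban R[i] X A f)
    (fun X => @banstaralg_mor_subdirect R X)
    (fun X A f H => H) (fun X A f H => H)
    (fun A Q X a h phi psi am hm hs =>
       @banstaralg_mor_quotient R A Q h hm hs X a phi psi am)).
- exact: (@forgetful_monadic R (comCstarAlgType R[i]) (fun A => A)
    (@comCstar_has_free_algebras R) (@comCstar_has_quotients R)
    (comBanachAlgType R[i]) (fun A => A)
    (fun X Y f => @banalg_mor R[i] X Y f)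
    (fun X => @banalg_mor_id R[i] X)
    (fun X Y Z => @banalg_mor_comp R[i] X Y Z)
    (fun X Y f => @banalg_mor_ban R[i] X Y f)
    (CStarc1_to_BanAlgc1 R) (fun A => id) (fun A => id)
    (fun A => @ban_mor_id R[i] A) (fun A => @ban_mor_id R[i] A)
    (fun A _ => erefl) (fun A _ => erefl) (fun A B f _ => erefl)
    (fun X A f => @banalg_mor R[i] X A f)
    (fun X A f => @banalg_mor_ban R[i] X A f)
    (fun X => @banalg_mor_subdirect R X)
    (fun X A f H => H) (fun X A f H => H)
    (fun A Q X a h phi psi am hm hs =>
       @banalg_mor_quotient R A Q h hm hs X a phi psi am)).
- exact: (@forgetful_monadic R (comCstarAlgType R[i]) (fun A => A)
    (@comCstar_has_free_algebras R) (@comCstar_has_quotients R)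
    (completeNormedModType R[i]) (fun A => A)
    (fun X Y f => @ban_mor R[i] X Y f)
    (fun X => @ban_mor_id R[i] X)
    (fun X Y Z => @ban_mor_comp R[i] X Y Z)
    (fun X Y f H => H)
    (CStarc1_to_Ban R) (fun A => id) (fun A => id)
    (fun A => @ban_mor_id R[i] A) (fun A => @ban_mor_id R[i] A)
    (fun A _ => erefl) (fun A _ => erefl) (fun A B f _ => erefl)
    (fun X A f => @ban_mor R[i] X A f)
    (fun X A f H => H)
    (fun X => @ban_mor_subdirect R X)
    (fun X A f H => H) (fun X A f H => H)
    (fun A Q X a h phi psi _ _ _ _ phib psib _ _ => conj phib psib)).
Qed.
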